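(* Fix an integer $n\ge1$. For every $k\ge 1$ let $$P_k(x)=I_n x^k+\sum_{j=0}^{k-1}C_j x^j$$ be a monic $n\times n$ complex random matrix polynomial of degree $k$, where the entries of the $n\times n$ random matrices $C_j=C_j^{(k)}$ are i.i.d. complex normal random variables with mean $0$ and variance $1$ (all of them independent also for varying $j$ and $k$). Then, for $k\to\infty$, the empirical spectral distribution of $P_k(x)$ converges almost surely to $\mathbf 1_U$, the uniform probability measure on the unit circumference $\{z\in\mathbb C:|z|=1\}$.
   Context: A complex normal random variable with mean $0$ and variance $1$ is the standard circularly symmetric one: real and imaginary parts are independent real $\mathcal N(0,1/2)$ variables. An $n\times n$ matrix polynomial $P(x)=\sum_{j=0}^k A_jx^j$ with $A_k$ invertible has exactly $kn$ finite eigenvalues $\lambda_1(P),\dots,\lambda_{kn}(P)$, namely the roots of $\det P(x)$ counted with multiplicity. The empirical spectral distribution (ESD) of a random matrix polynomial with (surely) invertible leading coefficient is the random probability measure $\mu_P=\frac1{kn}\sum_{i=1}^{kn}\delta_{\lambda_i(P)}$ on $\mathbb C$. Almost sure convergence of random probability measures $\mu_k$ to a deterministic probability measure $\mu$ means that, with probability 1, $\mu_k\to\mu$ in the vague (weak-$*$) topology of measures on $\mathbb C$. *)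

(* Defs.v *)
From HB Require Import structures.
From mathcomp Require Import all_boot all_order all_algebra.
From mathcomp Require Import fingroup perm finmap complex.
From mathcomp Require Import all_classical all_reals all_analysis
  measurable_realfun.

Set Implicit Arguments.
Unset Strict Implicit.
Unset Printing Implicit Defensive.

Import Order.TTheory GRing.Theory Num.Theory.
Import numFieldNormedType.Exports.

Local Open Scope classical_set_scope.
Local Open Scope complex_scope.
Local Open Scope ring_scope.

(* The complex numbers as a measurable space, with the Borel sigma-algebra.
   R[i]^o carries the topology of the modulus; its radii are elements e > 0 of
   R[i], and such an e is necessarily real. *)
Definition borelC (R : realType) : measurableType _ :=
  g_sigma_algebraType (@open R[i]^o).

Definition mutually_independent (d d' : measure_display)
    (T : measurableType d) (T' : measurableType d') (R : realType)
    (P : probability T R) (I : choiceType) (X : I -> T -> T') : Prop :=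
  forall (J : {fset I}) (A : I -> set T'), (forall i, measurable (A i)) ->
    P (\bigcap_(i in [set` J]) X i @^-1` A i) =
    (\prod_(i <- J) P (X i @^-1` A i))%E.

Definition independent2 (d d1 d2 : measure_display)
    (T : measurableType d) (T1 : measurableType d1) (T2 : measurableType d2)
    (R : realType) (P : probability T R) (X : T -> T1) (Y : T -> T2) : Prop :=
  forall A B, measurable A -> measurable B ->
    P (X @^-1` A `&` Y @^-1` B) = (P (X @^-1` A) * P (Y @^-1` B))%E.

Definition has_law (d d' : measure_display)
    (T : measurableType d) (T' : measurableType d') (R : realType)
    (P : probability T R) (X : T -> T') (mu : set T' -> \bar R) : Prop :=
  measurable_fun setT X /\
  forall A, measurable A -> P (X @^-1` A) = mu A.

(* normal_prob takes the standard deviation, hence N(0, 1/2) has parameter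
   sqrt (1/2). *)
Definition standard_complex_normal (d : measure_display)
    (T : measurableType d) (R : realType) (P : probability T R)
    (Z : {RV P >-> borelC R}) : Prop :=
  let X : T -> R := fun w => complex.Re (Z w) in
  let Y : T -> R := fun w => complex.Im (Z w) in
  [/\ has_law P X (normal_prob 0 (Num.sqrt 2^-1)),
      has_law P Y (normal_prob 0 (Num.sqrt 2^-1)) &
      independent2 P X Y].

Definition monic_mxpoly (F : nzRingType) (n k : nat) (C : 'I_k -> 'M[F]_n) :
    'M[{poly F}]_n :=
  'X^k%:M + \sum_(j < k) 'X^j *: map_mx polyC (C j).

Definition eigenvalues (F : closedFieldType) (n : nat) (M : 'M[{poly F}]_n) :
    seq F :=
  sval (closed_field_poly_normal (\det M)).

Lemma coef_prod_top (F : comNzRingType) (k : nat) (I : Type) (r : seq I)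
    (p : I -> {poly F}) :
  (forall i, (size (p i) <= k.+1)%N) ->
  (size (\prod_(i <- r) p i)%R <= (k * size r).+1)%N /\
  (\prod_(i <- r) p i)`_(k * size r) = \prod_(i <- r) (p i)`_k.
Proof.
move=> pk; elim: r => [|i r [IHs IHc]].
  by rewrite !big_nil muln0 size_poly1 coef1.
rewrite !big_cons /=; split.
  apply: (leq_trans (size_polyMleq _ _)).
  rewrite -subn1 leq_subLR add1n mulnS -addSn -addnS.
  exact: leq_add (pk i) IHs.
rewrite mulnS coefM (bigD1 (inord k)) //= inordK ?ltnS ?leq_addr//.
rewrite addKn IHc [X in _ + X]big1 ?addr0// => j jk.
have [jltk|kltj|jek] := ltngtP j k.
- rewrite (nth_default 0 (_ : (size (\prod_(j <- r) p j)%R <= _)%N)) ?mulr0//.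
  by apply: (leq_trans IHs); rewrite ltn_subRL ltn_add2r.
- by rewrite (nth_default 0 (_ : (size (p i) <= j)%N)) ?mul0r// (leq_trans (pk i)).
- by move/eqP: jk; case; apply/val_inj; rewrite /= inordK ?ltnS ?leq_addr.
Qed.

Lemma size_det_monic_mxpoly (F : comNzRingType) (n k : nat)
    (C : 'I_k -> 'M[F]_n) :
  size (\det (monic_mxpoly C)) = (k * n).+1.
Proof.
have coefME a b : (monic_mxpoly C) a b =
    'X^k *+ (a == b) + \sum_(j < k) (C j a b) *: 'X^j.
  rewrite !mxE summxE; congr (_ + _); apply: eq_bigr => j _.
  by rewrite !mxE mulrC mul_polyC.
have ssum a b : (size (\sum_(j < k) (C j a b) *: 'X^j : {poly F})%R <= k)%N.
  apply: (leq_trans (size_sum _ _ _)); apply/bigmax_leqP => j _.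
  by rewrite (leq_trans (size_scale_leq _ _))// size_polyXn ltn_ord.
have szM a b : (size ((monic_mxpoly C) a b) <= k.+1)%N.
  rewrite coefME (leq_trans (size_polyD _ _))// geq_max.
  rewrite (leq_trans (ssum a b))// andbT; case: (a == b).
    by rewrite mulr1n size_polyXn.
  by rewrite mulr0n size_poly0.
have topM a b : ((monic_mxpoly C) a b)`_k = (a == b)%:R.
  rewrite coefME coefD coefMn coefXn eqxx [X in _ + X]nth_default ?addr0//.
have idx : size (index_enum 'I_n) = n.
  by rewrite -[LHS]/(size (index_enum _)) [index_enum _]unlock -enumT size_enum_ord.
have szprod (s : 'S_n) :
    (size (\prod_i (monic_mxpoly C) i (s i))%R <= (k * n).+1)%N.
  by have [+ _] := coef_prod_top (index_enum 'I_n) (fun i => szM i (s i)); rewrite idx.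
have topprod (s : 'S_n) :
    (\prod_i (monic_mxpoly C) i (s i))`_(k * n) = (s == 1%g)%:R.
  have [_ ] := coef_prod_top (index_enum 'I_n) (fun i => szM i (s i)).
  rewrite idx => ->; have [->|s1] := eqVneq s 1%g.
    by rewrite big1// => i _; rewrite topM perm1 eqxx.
  have [i si] : exists i, i != s i.
    apply/existsP; apply: contraNT s1 => /existsPn h; apply/eqP/permP => i.
    by rewrite perm1; apply/esym/eqP; have := h i; rewrite negbK.
  by rewrite (bigD1 i)//= topM (negbTE si) mul0r.
apply/anti_leq/andP; split.
  apply: (leq_trans (size_sum _ _ _)); apply/bigmax_leqP => s _.
  by rewrite -signr_odd; case: (odd _); rewrite ?expr1 ?expr0 ?mulN1r ?mul1r ?size_polyN.
rewrite ltnNge; apply/negP => /(nth_default 0) /eqP.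
rewrite coef_sum (bigD1 (1%g : 'S_n))//= odd_perm1 expr0 mul1r topprod eqxx.
rewrite big1 ?addr0 ?oner_eq0// => s s1.
rewrite -signr_odd; case: (odd _); rewrite ?expr1 ?expr0 ?mulN1r ?mul1r ?coefN topprod (negbTE s1) ?oppr0//.
Qed.

Lemma size_eigenvalues_monic_mxpoly (F : closedFieldType) (n k : nat)
    (C : 'I_k -> 'M[F]_n) :
  size (eigenvalues (monic_mxpoly C)) = (k * n)%N.
Proof.
rewrite /eigenvalues; case: closed_field_poly_normal => s /= E.
have := size_det_monic_mxpoly C; rewrite {1}E => sz.
have c0 : lead_coef (\det (monic_mxpoly C)) != 0.
  by rewrite lead_coef_eq0 -size_poly_eq0 size_det_monic_mxpoly.
by move: sz; rewrite size_scale// size_prod_XsubC => -[].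
Qed.

(* Meaningful when M has degree k with invertible leading coefficient, so that
   eigenvalues M has exactly k * n elements. *)
Definition esd (R : realType) (n k : nat) (M : 'M[{poly R[i]}]_n) :
    {measure set (borelC R) -> \bar R} :=
  mscale (((k * n)%:R : R)^-1)%:nng
    (msum (fun i => \d_((eigenvalues M)`_i : borelC R)) (k * n)).

Definition circle_point (R : realType) (t : measurableTypeR R) : borelC R :=
  (cos (t : R) +i* sin (t : R))%C.

Lemma measurable_circle_point (R : realType) :
  measurable_fun setT (@circle_point R).
Proof.
apply: (@measurability _ _ _ (borelC R) _ _ (@open R[i]^o)) => //.
move=> _ [U oU <-]; rewrite setTI; apply: (@open_measurable R).
rewrite openE => t Ut; rewrite /interior/=.
have /nbhs_ballP[e e0 eU] : nbhs (circle_point t : R[i]^o) U.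
  by apply: open_nbhs_nbhs; split.
have [d d0 de] : exists2 d : R, 0 < d & d%:C = e.
  move: e0 => /= e0; exists (complex.Re e).
    by move: e0; rewrite ltcE /= => /andP[].
  by rewrite RRe_real// gtr0_real.
have d20 : 0 < d / 2 by rewrite divr_gt0.
have nc := @continuous_cos R t; have ns := @continuous_sin R t.
have /cvgrPdist_lt /(_ _ d20) hc := nc.
have /cvgrPdist_lt /(_ _ d20) hs := ns.
near=> u; apply: eU; rewrite /ball/= /ball_/= -de.
have -> : (circle_point t : R[i]) - circle_point u =
    (cos t - cos u)%:C + 'i%C * (sin t - sin u)%:C :> R[i].
  by rewrite /circle_point; apply/eqP; rewrite eq_complex /=; simpc.
apply: (le_lt_trans (ler_normD _ _)).
rewrite normrM !normc_def /= !expr0n expr1n /= !addr0 add0r sqrtr1 mul1r !sqrtr_sqr -rmorphD /=.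
by rewrite ltcR [ltRHS]splitr ltrD//; near: u.
Unshelve. all: end_near. Qed.

HB.instance Definition _ (R : realType) :=
  isMeasurableFun.Build _ _ _ _ (@circle_point R) (@measurable_circle_point R).

Lemma ltr0_2pi (R : realType) : 0 < 2 * pi :> R.
Proof. by rewrite mulr_gt0 ?pi_gt0. Qed.

Definition unif_circle (R : realType) : probability (borelC R) R :=
  distribution (uniform_prob (ltr0_2pi R)) (@circle_point R).

Lemma esd_monic_mxpolyT (R : realType) (n k : nat) (C : 'I_k -> 'M[R[i]]_n) :
  (0 < n)%N -> (0 < k)%N -> esd k (monic_mxpoly C) setT = 1%E.
Proof.
move=> n0 k0; rewrite /esd /= /mscale/= /msum/=.
under eq_bigr do rewrite diracT.
rewrite sumEFin sumr_const card_ord -EFinM mulVf//.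
by rewrite pnatr_eq0 -lt0n muln_gt0 k0.
Qed.

(* Convergence in the vague topology: pairing with continuous functions of
   compact support. *)
Definition vague_cvg (R : realType)
    (mu_ : nat -> {measure set (borelC R) -> \bar R})
    (mu : {measure set (borelC R) -> \bar R}) : Prop :=
  forall f : R[i]^o -> R, continuous f ->
    compact (closure [set z | f z != 0]) ->
    (fun k => \int[mu_ k]_z (f z)%:E)%E @ \oo --> (\int[mu]_z (f z)%:E)%E.

(* Main.v *)
Require Import Defs.
From HB Require Import structures.
From mathcomp Require Import all_boot all_order all_algebra.
From mathcomp Require Import fingroup perm finmap complex ring lra.
From mathcomp Require Import all_classical all_reals all_analysis
  measurable_realfun.

Set Implicit Arguments.
Unset Strict Implicit.
Unset Printing Implicit Defensive.

Import Order.TTheory GRing.Theory Num.Theory Normc.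
Import numFieldNormedType.Exports.

Local Open Scope classical_set_scope.
Local Open Scope complex_scope.
Local Open Scope ring_scope.

(* Let z range over the N = kn roots of p = det P_k, and let A bound the
   modulus of the entries of the coefficients. Replacing each root inside the
   unit disc by its reflection in the circle does not change the l2-norm of the
   coefficients of p and gives, up to a constant of modulus at least 1, a
   product of factors 1 - a x with |a| <= 1, where a has the argument of the
   conjugate of z. When A and 1/|p(0)| are polynomial in k this product is
   e^(o(N)) on the closed disc. Hence the sum of the 1 - |a| is o(N), so most
   roots are close to the circle; and since ln |1 - y| >= - Re y - O(|y|^2),
   evaluating the product along the orbits of the m-th roots of unity shows that
   the sum of the a^m is o(N) for every m >= 1. Weyl's criterion, in the form of
   Fejer averages, then gives equidistribution.

   The polynomial bounds hold almost surely for large k by Borel-Cantelli: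
   Gaussian tails control the entries, and P(|det C_0| < e^(2^n)) = O(e) follows
   by induction on n, as det C_0 = g D + S with the entry g independent of the
   pair (D, S). *)

(** * Reflecting the roots of a polynomial in the unit circle *)

(** The reflection is there because a root z inside the disc gives a factor 1 - x / z that cannot be
    expanded for |x| of fixed size; after reflection every factor 1 - a x has |a| <= 1, so one
    radius t <= 1/8 serves all of them. An upper bound on the product is one-sided information, but
    x may be rotated freely, and this bounds the modulus of the sum of the a. Passing from a to a^m
    replaces a bound B by B^m, a loss of a factor m in the logarithm. The exponent 2^n in the small
    ball estimate comes from the step |g D + S| < e^2, which either makes |D| < e or confines g to a
    strip of width O(e): each expansion of the determinant costs a square. As n is fixed, 1/|p(0)|
    is still bounded by a power of k, and the logarithm of any power of k is o(N). In the last step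
    the test function is never approximated by trigonometric polynomials: each value f(w) is written
    as the integral of f(w) times the Fejer kernel centred at w. *)

Section Reflection.
Variable F : numClosedFieldType.
Implicit Types (z x : F) (zs : seq F) (p q : {poly F}).

(** The reciprocal of whichever of z and its mirror image 1 / z^* lies outside the open disc; its
    modulus is min(|z|, 1/|z|) for z != 0, and it sends 0 to 0. *)
Definition disc_reflect z : F := if 1 <= `|z| then z^-1 else z^*.

Definition reflected_factor z : {poly F} :=
  if 1 <= `|z| then 'X - z%:P else 1 - z^* *: 'X.

(** The difference of the two squares at index j is (|q_(j-1)|^2 - |q_j|^2) (1 - |z|^2), so the sum
    telescopes; the size bound makes the last coefficient vanish. *)
Lemma sum_sqr_coef_reflect z q m : (size q <= m)%N ->
  \sum_(j < m.+1) `|(('X - z%:P) * q)`_j| ^+ 2 =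
  \sum_(j < m.+1) `|((1 - z^* *: 'X) * q)`_j| ^+ 2.
Proof.
move=> qm; apply/eqP; rewrite -subr_eq0 -sumrB.
under eq_bigr => j _.
  have -> : `|(('X - z%:P) * q)`_j| ^+ 2 - `|((1 - z^* *: 'X) * q)`_j| ^+ 2 =
     (`|('X * q)`_j| ^+ 2 - `|q`_j| ^+ 2) * (1 - `|z| ^+ 2).
    rewrite !mulrBl mul1r -scalerAl !coefB coefCM coefZ !normCK !rmorphB !rmorphM /=.
    by rewrite conjCK; ring.
  over.
rewrite -mulr_suml sumrB big_ord_recl coefXM /= normr0 expr0n add0r.
under eq_bigr => j _ do rewrite coefXM /= add0n.
by rewrite big_ord_recr /= (nth_default _ qm) normr0 expr0n addr0 subrr mul0r.
Qed.

Lemma size_reflected_factor z : (size (reflected_factor z) <= 2)%N.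
Proof.
rewrite /reflected_factor; case: ifP => _; first by rewrite size_XsubC.
rewrite (leq_trans (size_polyD _ _))// size_polyN size_poly1 geq_max /=.
by rewrite (leq_trans (size_scale_leq _ _))// size_polyX.
Qed.

Lemma size_prod_reflected_factor zs q :
  (size (\prod_(z <- zs) reflected_factor z * q)%R <= size zs + size q)%N.
Proof.
elim: zs => [|z zs IH]; first by rewrite big_nil mul1r.
rewrite big_cons -mulrA (leq_trans (size_polyMleq _ _))// -subn1 leq_subLR /=.
by rewrite addnA -[(1 + _)%N]/((size zs).+2) -add2n -addnA leq_add// size_reflected_factor.
Qed.

(** The arbitrary cofactor [q] lets the induction reflect one factor at a time, the others being
    absorbed in it. *)
Lemma sum_sqr_coef_prod_reflected zs q m : (size zs + size q <= m)%N ->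
  \sum_(j < m) `|(\prod_(z <- zs) ('X - z%:P) * q)`_j| ^+ 2 =
  \sum_(j < m) `|(\prod_(z <- zs) reflected_factor z * q)`_j| ^+ 2.
Proof.
elim: zs q m => [|z zs IH] q m; first by rewrite !big_nil.
rewrite !big_cons /= => szm.
have szq : (size (('X - z%:P) * q)%R <= (size q).+1)%N.
  by rewrite (leq_trans (size_polyMleq _ _))// size_XsubC.
rewrite -[_ * _ * q in LHS]mulrA [_ * (_ * q) in LHS]mulrCA.
rewrite IH; last by rewrite (leq_trans _ szm)// addSn -addnS leq_add2l.
rewrite [_ * (_ * q) in LHS]mulrCA -[_ * _ * q in RHS]mulrA.
rewrite {2}/reflected_factor; case: ifP => // _.
case: m szm => // m szm.
by rewrite sum_sqr_coef_reflect// (leq_trans (size_prod_reflected_factor _ _)).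
Qed.

Lemma normr_disc_reflect_le1 z : `|disc_reflect z| <= 1.
Proof.
rewrite /disc_reflect; case: ifPn => [z1|].
  by rewrite normfV invf_le1// (lt_le_trans ltr01).
by rewrite norm_conjC real_leNgt ?realE ?ler01 ?normr_ge0// negbK => /ltW.
Qed.

(** Here c is the product of the - z over the roots with |z| >= 1, so |c| is the Mahler measure. The
    moduli |a| multiply to the product of the inner |z| divided by |c|, whereas |p(0)| is that
    product times |c|; hence the square. *)
Lemma prod_reflected_factorE zs :
  exists2 c : F, 1 <= `|c| &
    \prod_(z <- zs) reflected_factor z =
      c *: \prod_(z <- zs) (1 - disc_reflect z *: 'X) /\
    `|(\prod_(z <- zs) ('X - z%:P))`_0| =
      `|c| ^+ 2 * \prod_(z <- zs) `|disc_reflect z|.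
Proof.
elim: zs => [|z zs [c c1 [Ep E0]]].
  exists 1; first by rewrite normr1.
  by rewrite !big_nil scale1r coef1 normr1 expr1n mulr1.
rewrite !big_cons coef0M normrM E0 Ep coefB coefX coefC /= sub0r normrN.
rewrite /reflected_factor /disc_reflect; case: ifPn => z1.
  have z0 : z != 0 by rewrite -normr_gt0 (lt_le_trans ltr01).
  exists (- z * c); first by rewrite normrM normrN mulr_ege1.
  split; first last.
    rewrite normrM normrN normfV; have : `|z| != 0 by rewrite normr_eq0.
    by move=> ?; field.
  have -> : 'X - z%:P = - z *: (1 - z^-1 *: 'X).
    rewrite scalerBr scalerA mulNr divff// scaleN1r opprK scaleNr alg_polyC.
    by rewrite addrC.
  by rewrite -scalerAl -scalerAr scalerA.
exists c => //; split; first by rewrite -scalerAr.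
by rewrite norm_conjC mulrCA.
Qed.

Lemma norm_horner_le_sum_coef p x m : (size p <= m)%N -> `|x| <= 1 ->
  `|p.[x]| <= \sum_(j < m) `|p`_j|.
Proof.
move=> pm x1; rewrite (horner_coef_wide _ pm) (le_trans (ler_norm_sum _ _ _))//.
apply: ler_sum => j _; rewrite normrM normrX ler_piMr//.
by rewrite exprn_ile1.
Qed.

(* Landau's inequality: trading the roots inside the disc for their
   reflections preserves the l2-norm of the coefficients. *)
Lemma reflected_roots_bound zs (H : F) (N := size zs) :
  (forall j, `|(\prod_(z <- zs) ('X - z%:P))`_j| <= H) ->
  (forall x, `|x| <= 1 ->
     \prod_(z <- zs) `|1 - disc_reflect z * x| <= N.+1%:R ^+ 2 * H) /\
  `|(\prod_(z <- zs) ('X - z%:P))`_0| <=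
    (N.+1%:R * H) ^+ 2 * \prod_(z <- zs) `|disc_reflect z|.
Proof.
move=> pH; have H0 : 0 <= H by exact: le_trans (normr_ge0 _) (pH 0).
set r := \prod_(z <- zs) reflected_factor z.
have szr : (size r <= N.+1)%N.
  have := size_prod_reflected_factor zs 1.
  by rewrite mulr1 size_poly1 addn1.
(* The factor N + 1 is rounded up to its square so that the bound is a square and passes to each
   single coefficient. *)
have rE : \sum_(j < N.+1) `|r`_j| ^+ 2 <= (N.+1%:R * H) ^+ 2.
  have := @sum_sqr_coef_prod_reflected zs 1 N.+1.
  rewrite !mulr1 size_poly1 addn1 => /(_ (leqnn _)) <-.
  apply: (@le_trans _ _ (\sum_(j < N.+1) H ^+ 2)).
    by apply: ler_sum => j _; apply: lerXn2r; rewrite ?nnegrE.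
  rewrite sumr_const card_ord -[_ *+ _]mulr_natl exprMn ler_wpM2r ?exprn_ge0//.
  by rewrite -natrX ler_nat -{1}[N.+1]expn1 leq_pexp2l.
have NH0 : 0 <= N.+1%:R * H by rewrite mulr_ge0.
have rj j : `|r`_j| <= N.+1%:R * H.
  have [jN|Nj] := ltnP j N.+1; last first.
    by rewrite nth_default ?normr0// (leq_trans szr).
  rewrite -(@ler_pXn2r _ 2) ?nnegrE// (le_trans _ rE)//.
  by rewrite (bigD1 (Ordinal jN)) //= lerDl sumr_ge0// => i _; rewrite exprn_ge0.
have [c c1 [Er E0]] := prod_reflected_factorE zs.
have c0 : c != 0 by rewrite -normr_gt0 (lt_le_trans ltr01).
split=> [x x1|].
  have -> : \prod_(z <- zs) `|1 - disc_reflect z * x| = `|r.[x]| / `|c|.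
    rewrite /r Er hornerZ normrM mulrAC divff ?normr_eq0// mul1r horner_prod normr_prod.
    by apply: eq_bigr => z _; rewrite !hornerE.
  rewrite ler_pdivrMr ?normr_gt0//; apply: (@le_trans _ _ (N.+1%:R ^+ 2 * H)).
    rewrite (le_trans (norm_horner_le_sum_coef szr x1))//.
    rewrite (le_trans (ler_sum _ (fun (j : 'I_N.+1) _ => rj j)))//.
    by rewrite sumr_const card_ord -[_ *+ _]mulr_natl mulrA expr2.
  by rewrite ler_peMr// mulr_ge0// ?exprn_ge0.
rewrite E0 ler_wpM2r ?prodr_ge0//.
(* The constant coefficient of [r] is c itself, whence |c| <= (N + 1) H. *)
have := rj 0; rewrite /r Er coefZ.
have -> : (\prod_(z <- zs) (1 - disc_reflect z *: 'X))`_0 = 1.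
  rewrite -horner_coef0 horner_prod big1// => z _.
  by rewrite !hornerE ?subr0.
by rewrite mulr1 => ?; apply: lerXn2r; rewrite ?nnegrE//.
Qed.

Lemma prodr_const_seq (I : Type) (r : seq I) x :
  \prod_(i <- r) x = x ^+ size r.
Proof. by rewrite big_const_seq count_predT -Monoid.iteropE. Qed.

Lemma prod_unity_roots m : (0 < m)%N ->
  exists us : seq F, [/\ size us = m, (forall u, u \in us -> `|u| = 1) &
    forall y, \prod_(u <- us) (1 - u * y) = 1 - y ^+ m].
Proof.
move=> m0; have [us E] := closed_field_poly_normal ('X^m - 1 : {poly F}).
have szE : size ('X^m - 1 : {poly F}) = m.+1 by rewrite size_XnsubC.
have lE : lead_coef ('X^m - 1 : {poly F}) = 1.
  by apply/eqP; exact: monicXnsubC.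
rewrite lE scale1r in E; exists us; split.
- by move: szE; rewrite E size_prod_XsubC => -[].
- move=> u uus; have : root ('X^m - 1) u by rewrite E root_prod_XsubC.
  rewrite rootE !hornerE subr_eq0 => /eqP um.
  apply/eqP; rewrite -(@pexpr_eq1 _ _ m)// -normrX um normr1//.
move=> y; have [->|y0] := eqVneq y 0.
  by rewrite big1 ?expr0n ?gtn_eqF ?subr0// => u _; rewrite mulr0 subr0.
have sz : size us = m by move: szE; rewrite E size_prod_XsubC => -[].
have : (('X^m - 1) : {poly F}).[y^-1] * y ^+ m = 1 - y ^+ m.
  by rewrite !hornerE mulrBl exprVn mulVf ?expf_neq0// mul1r.
move <-; rewrite E horner_prod -sz -prodr_const_seq -big_split /=.
apply: eq_bigr => u _; rewrite !hornerE mulrBl mulVf//.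
Qed.

(** Choose y with y^m = x. Over the m-th roots of unity u, the factors 1 - a u y multiply to 1 - a^m
    x, and the m bounds multiply to B^m. *)
Lemma prod_one_sub_pow_le (I : Type) (r : seq I) (a : I -> F) (B : F) m :
  (0 < m)%N ->
  (forall x, `|x| <= 1 -> \prod_(i <- r) `|1 - a i * x| <= B) ->
  forall x, `|x| <= 1 -> \prod_(i <- r) `|1 - a i ^+ m * x| <= B ^+ m.
Proof.
move=> m0 aB x x1; have [us [sz us1 usE]] := prod_unity_roots m0.
have [y yx] : exists y, y ^+ m = x.
  by exists (m.-root x); rewrite rootCK.
have y1 : `|y| <= 1.
  by rewrite -(@ler_pXn2r _ m) ?nnegrE ?expr1n// -normrX yx.
have -> : \prod_(i <- r) `|1 - a i ^+ m * x| =
    \prod_(u <- us) \prod_(i <- r) `|1 - a i * (u * y)|.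
  rewrite exchange_big; apply: eq_bigr => i _.
  rewrite -normr_prod -yx -exprMn -usE; congr `|_|.
  by apply: eq_bigr => u _; rewrite mulrCA.
rewrite -sz -prodr_const_seq [X in X <= _]big_seq_cond [X in _ <= X]big_seq_cond.
apply: ler_prod => u; rewrite andbT => uus; rewrite prodr_ge0//=.
by apply: aB; rewrite normrM us1// mul1r.
Qed.

End Reflection.

(** * Coefficient majorants and the size of the determinant *)

Section Majorant.
Variable F : numDomainType.
Implicit Types p q P Q : {poly F}.

Definition coef_dominated p P := forall j, `|p`_j| <= P`_j.

Lemma coef_dominatedD p q P Q :
  coef_dominated p P -> coef_dominated q Q -> coef_dominated (p + q) (P + Q).
Proof. by move=> pP qQ j; rewrite !coefD (le_trans (ler_normD _ _))// lerD. Qed.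

Lemma coef_dominatedM p q P Q :
  coef_dominated p P -> coef_dominated q Q -> coef_dominated (p * q) (P * Q).
Proof.
move=> pP qQ j; rewrite !coefM (le_trans (ler_norm_sum _ _ _))//.
by apply: ler_sum => i _; rewrite normrM ler_pM.
Qed.

Lemma coef_dominated_sum (I : Type) (r : seq I) (p P : I -> {poly F}) :
  (forall i, coef_dominated (p i) (P i)) ->
  coef_dominated (\sum_(i <- r) p i) (\sum_(i <- r) P i).
Proof.
move=> pP; apply: (big_ind2 coef_dominated) => //.
- by move=> j; rewrite coef0 normr0.
- by move=> *; exact: coef_dominatedD.
Qed.

Lemma coef_dominated_prod (I : Type) (r : seq I) (p P : I -> {poly F}) :
  (forall i, coef_dominated (p i) (P i)) ->
  coef_dominated (\prod_(i <- r) p i) (\prod_(i <- r) P i).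
Proof.
move=> pP; apply: (big_ind2 coef_dominated) => //.
- by move=> j; rewrite coef1 normr_nat.
- by move=> *; exact: coef_dominatedM.
Qed.

Lemma coef_dominated_le p P j : coef_dominated p P -> `|p`_j| <= P.[1].
Proof.
move=> pP; have P0 i : 0 <= P`_i by exact: le_trans (normr_ge0 _) (pP i).
rewrite (le_trans (pP j))// horner_coef.
have [jP|Pj] := ltnP j (size P).
  rewrite (bigD1 (Ordinal jP))//= expr1n mulr1 lerDl sumr_ge0// => i _.
  by rewrite expr1n mulr1.
by rewrite nth_default// sumr_ge0// => i _; rewrite expr1n mulr1.
Qed.

End Majorant.

Lemma monic_mxpolyE (F : comNzRingType) (n k : nat) (C : 'I_k -> 'M[F]_n) a b :
  monic_mxpoly C a b = 'X^k *+ (a == b) + \sum_(j < k) C j a b *: 'X^j.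
Proof.
rewrite !mxE summxE; congr (_ + _); apply: eq_bigr => j _.
by rewrite !mxE mulrC mul_polyC.
Qed.

(** Every entry is dominated by X^k + T (1 + ... + X^(k-1)), whose value at 1 is 1 + k T, and the
    Leibniz formula has n! terms with n entries each. *)
Lemma norm_coef_det_monic_mxpoly (F : numDomainType) (n k : nat)
    (C : 'I_k -> 'M[F]_n) (T : F) :
  (forall j a b, `|C j a b| <= T) ->
  forall i, `|(\det (monic_mxpoly C))`_i| <= n`!%:R * (1 + k%:R * T) ^+ n.
Proof.
move=> CT i; pose E : {poly F} := 'X^k + \sum_(j < k) T *: 'X^j.
have entryE a b : coef_dominated (monic_mxpoly C a b) E.
  rewrite monic_mxpolyE; apply: coef_dominatedD => [j|].
    by rewrite coefMn coefXn; case: (a == b); case: eqP; rewrite ?normr1 ?normr0.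
  apply: coef_dominated_sum => j l; rewrite !coefZ coefXn normrM normr_nat.
  by rewrite ler_wpM2r.
have detE : coef_dominated (\det (monic_mxpoly C))
    (\sum_(s : 'S_n) \prod_(a < n) E).
  apply: coef_dominated_sum => s.
  have -> : \prod_(a < n) E = 1 * \prod_(a < n) E by rewrite mul1r.
  apply: coef_dominatedM; last exact: coef_dominated_prod.
  by move=> j; rewrite -signr_odd; case: odd;
    rewrite ?expr1 ?expr0 ?coefN coef1 ?normrN normr_nat ?coef1.
rewrite (le_trans (coef_dominated_le i detE))//.
rewrite horner_sum; under eq_bigr do rewrite horner_prod.
rewrite sumr_const card_Sn prodr_const card_ord.
rewrite /E hornerD hornerXn expr1n horner_sum.
under eq_bigr do rewrite hornerZ hornerXn expr1n mulr1.
by rewrite sumr_const card_ord !mulr_natl.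
Qed.

(** * Power sums of the roots *)

Section Normc.
Variable R : rcfType.
Implicit Types x y z : R[i].

Lemma normc_ge0 x : 0 <= normc x.
Proof. by rewrite -(ler0c (normc x)) -[_%:C]/(`|x|) normr_ge0. Qed.

Lemma sqr_normcE x : normc x ^+ 2 = complex.Re x ^+ 2 + complex.Im x ^+ 2.
Proof. by case: x => a b /=; rewrite sqr_sqrtr// addr_ge0 ?sqr_ge0. Qed.

Lemma normc_gt0 x : (0 < normc x) = (x != 0).
Proof. by rewrite -(ltcR 0) -[(normc x)%:C]/(`|x|) normr_gt0. Qed.

Lemma ler_Re_normc x : `|complex.Re x| <= normc x.
Proof. by rewrite -lecR; exact: normc_ge_Re. Qed.

Lemma normcX x n : normc (x ^+ n) = normc x ^+ n.
Proof. by elim: n => [|n IH]; rewrite ?expr0 ?normc1// !exprS normcM IH. Qed.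

Lemma normcR (a : R) : normc a%:C = `|a|.
Proof. by rewrite /= expr0n addr0 sqrtr_sqr. Qed.

Lemma le_normc_sum (I : Type) (r : seq I) (f : I -> R[i]) :
  normc (\sum_(i <- r) f i) <= \sum_(i <- r) normc (f i).
Proof.
apply: (big_ind2 (fun a b => normc a <= b)); rewrite ?normc0//.
by move=> x a y b xa yb; rewrite (le_trans (le_normcD _ _))// lerD.
Qed.

Lemma Re_sum (I : Type) (r : seq I) (f : I -> R[i]) :
  complex.Re (\sum_(i <- r) f i) = \sum_(i <- r) complex.Re (f i).
Proof. by apply: (big_morph (@complex.Re R)) => // -[a b] [c d]. Qed.

Lemma normc_one_sub_sqr x :
  normc (1 - x) ^+ 2 = 1 + (normc x ^+ 2 - complex.Re x *+ 2).
Proof. by rewrite !sqr_normcE; case: x => a b /=; ring. Qed.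

End Normc.

Section LogEstimates.
Variable R : realType.
Implicit Types x y : R.

(** Apply ln (1 + v) <= v to the inverse of 1 + y: ln (1 + y) >= y / (1 + y) = y - y^2 / (1 + y),
    and 1 + y >= 1/2. *)
Lemma ln1Dx_ge y : `|y| <= 2^-1 -> y - 2 * y ^+ 2 <= ln (1 + y).
Proof.
rewrite ler_norml => /andP[y1 y2].
have y0 : 0 < 1 + y by lra.
rewrite -[ln _]opprK -lnV ?posrE// lerNr opprB.
have -> : (1 + y)^-1 = 1 + - (y / (1 + y)) by field; rewrite gt_eqF.
apply: le_trans (le_ln1Dx _) _.
  by rewrite ltrN2 ltr_pdivrMr// mul1r; lra.
rewrite lerNl opprB ler_pdivlMr//; nra.
Qed.

(** With y = |x|^2 - 2 Re x, 2 ln |1 - x| = ln (1 + y) and |y| <= (17/8) |x|. The radius 1/8 gives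
    |y| <= 1/2, and the quadratic loss (17/8)^2 - 1/2 is below 5. *)
Lemma ln_normc_one_sub_ge (x : R[i]) : normc x <= 8^-1 ->
  - complex.Re x - 5 * normc x ^+ 2 <= ln (normc (1 - x)).
Proof.
move=> x8; have x0 := normc_ge0 x.
have /ler_normlP[r1 r2] := ler_Re_normc x.
set y := normc x ^+ 2 - complex.Re x *+ 2.
have yE : y = normc x ^+ 2 - complex.Re x * 2 by rewrite /y mulr_natr.
have ylow : - (normc x * 2) <= y by rewrite yE; nra.
have yup : y <= normc x * (2 + 8^-1) by rewrite yE; nra.
have y2 : `|y| <= 2^-1 by rewrite ler_norml; apply/andP; split; lra.
have nx0 : 0 < normc (1 - x).
  rewrite lt_neqAle normc_ge0 andbT; apply/negP => /eqP E.
  by move: (normc_one_sub_sqr x); rewrite -E expr0n -/y => /=; move: y2; rewrite ler_norml => /andP[]; lra.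
have : ln (normc (1 - x)) *+ 2 = ln (1 + y) by rewrite -lnXn// normc_one_sub_sqr.
have := ln1Dx_ge y2; have y2le : y ^+ 2 <= (normc x * (2 + 8^-1)) ^+ 2.
  have ya : `|y| <= normc x * (2 + 8^-1) by rewrite ler_norml; apply/andP; split; lra.
  by rewrite -[y ^+ 2]real_normK ?num_real//; apply: lerXn2r; rewrite ?nnegrE// (le_trans _ ya).
rewrite -mulr_natr; move: y2le; rewrite exprMn yE; nra.
Qed.

End LogEstimates.

Section PowerSums.
Variable R : realType.
Implicit Types (z w : R[i]) (zs : seq R[i]).

Lemma normr_normc z : `|z| = (normc z)%:C. Proof. by []. Qed.

Lemma exists_unit_rotation z : exists2 u : R[i], normc u = 1 &
  u * z = (- normc z)%:C.
Proof.
have [->|z0] := eqVneq z 0.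
  by exists 1; rewrite ?normc1// mulr0 normc0 oppr0.
exists (- (z^-1 * (normc z)%:C)).
  rewrite normcN normcM normcV normcR ger0_norm ?normc_ge0//.
  by rewrite mulVf// gt_eqF// normc_gt0.
by rewrite mulNr mulrAC mulVf// mul1r rmorphN.
Qed.

(* Take x = t * u with |u| = 1 and u * sum a = - |sum a|, and sum the
   inequalities ln |1 - a x| >= - Re (a x) - 5 |a x|^2. *)
Lemma normc_sum_le_ln (r : seq R[i]) (B t : R) : 0 < t <= 8^-1 ->
  {in r, forall a, normc a <= 1} ->
  (forall x, normc x <= 1 -> \prod_(a <- r) normc (1 - a * x) <= B) ->
  t * normc (\sum_(a <- r) a) <= ln B + 5 * t ^+ 2 * (size r)%:R.
Proof.
move=> /andP[t0 t8] r1 rB; have [u u1 uE] := exists_unit_rotation (\sum_(a <- r) a).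
have small a : a \in r -> normc (a * (t%:C * u)) <= t.
  move=> /r1 a1; rewrite !normcM u1 mulr1 normcR gtr0_norm// ler_piMl// ltW//.
have pos a : a \in r -> 0 < normc (1 - a * (t%:C * u)).
  move=> ar; rewrite normc_gt0 subr_eq0; apply/eqP => E.
  by have := small _ ar; rewrite -E normc1 => t1; move: t8; lra.
have tu1 : normc (t%:C * u) <= 1.
  by rewrite normcM u1 mulr1 normcR gtr0_norm//; lra.
have {rB} := rB _ tu1 => PB.
have lnP : ln (\prod_(a <- r) normc (1 - a * (t%:C * u))) =
    \sum_(a <- r) ln (normc (1 - a * (t%:C * u))) /\
    0 < \prod_(a <- r) normc (1 - a * (t%:C * u)).
  elim: r pos {r1 uE small PB} => [_|a r IH pos]; first by rewrite !big_nil ln1.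
  have [|E P0] := IH; first by move=> b br; apply: pos; rewrite inE br orbT.
  have a0 : 0 < normc (1 - a * (t%:C * u)) by apply: pos; rewrite inE eqxx.
  by rewrite !big_cons lnM ?posrE// E mulr_gt0.
have lnB : \sum_(a <- r) ln (normc (1 - a * (t%:C * u))) <= ln B.
  by rewrite -lnP.1 ler_ln ?posrE//; [exact: lnP.2|exact: lt_le_trans lnP.2 PB].
have lower : \sum_(a <- r) (- complex.Re (a * (t%:C * u)) - 5 * t ^+ 2) <=
    \sum_(a <- r) ln (normc (1 - a * (t%:C * u))).
  rewrite big_seq [leRHS]big_seq; apply: ler_sum => a ar.
  have a8 : normc (a * (t%:C * u)) <= 8^-1 by exact: le_trans (small _ ar) t8.
  apply: le_trans (ln_normc_one_sub_ge a8).
  by rewrite lerD2l lerN2 ler_pM2l//; apply: lerXn2r; rewrite ?nnegrE ?normc_ge0 ?small// ltW.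
have : \sum_(a <- r) (- complex.Re (a * (t%:C * u)) - 5 * t ^+ 2) =
    t * normc (\sum_(a <- r) a) - 5 * t ^+ 2 * (size r)%:R.
  rewrite sumrB big_const_seq count_predT iter_addr_0 mulr_natr; congr (_ - _).
  rewrite sumrN -Re_sum -mulr_suml mulrCA [_ * u]mulrC uE -rmorphM /= mulrN opprK.
  by [].
lra.
Qed.

(** Sum 1 - a <= - ln a. Applied to the moduli of the reflections, it turns a lower bound on |p(0)|
    into closeness of most roots to the circle. *)
Lemma sum_one_sub_le_ln (r : seq R) (e : R) :
  0 < e -> {in r, forall a, 0 < a} -> e <= \prod_(a <- r) a ->
  \sum_(a <- r) (1 - a) <= - ln e.
Proof.
move=> e0 r0 er.
have lnP : ln (\prod_(a <- r) a) = \sum_(a <- r) ln a /\ 0 < \prod_(a <- r) a.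
  elim: r r0 {er} => [_|a r IH pos]; first by rewrite !big_nil ln1.
  have [|E P0] := IH; first by move=> b br; apply: pos; rewrite inE br orbT.
  have a0 : 0 < a by apply: pos; rewrite inE eqxx.
  by rewrite !big_cons lnM ?posrE// E mulr_gt0.
rewrite lerNr -sumrN; apply: (@le_trans _ _ (\sum_(a <- r) ln a)).
  by rewrite -lnP.1 ler_ln ?posrE//; exact: lnP.2.
rewrite big_seq [leRHS]big_seq; apply: ler_sum => a ar.
rewrite opprB -{1}[a](subrK 1) addrC; apply: le_ln1Dx.
by have := r0 _ ar; lra.
Qed.

Definition direction z : R[i] := z / (normc z)%:C.

Lemma normc_direction z : z != 0 -> normc (direction z) = 1.
Proof.
by move=> z0; rewrite normcM normcV normcR ger0_norm ?normc_ge0// divff// gt_eqF// normc_gt0.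
Qed.

Lemma conjC_normc z : (z^* * z)%R = ((normc z) ^+ 2)%:C.
Proof. by rewrite mulrC -normCK normr_normc rmorphXn. Qed.

Lemma disc_reflectE z : z != 0 ->
  disc_reflect z = (normc (disc_reflect z))%:C * (direction z)^*%R.
Proof.
move=> z0; have nz : (normc z)%:C != 0 by rewrite (inj_eq (@complexI R)) gt_eqF// normc_gt0.
have zc : z^-1 = z^*%R / ((normc z) ^+ 2)%:C.
  by rewrite -conjC_normc invfM mulrA divff ?mul1r// conjC_eq0.
have cd : (direction z)^*%R = z^*%R / (normc z)%:C.
  by rewrite rmorphM fmorphV /= /direction; congr (_ / _); rewrite -normr_normc conj_normC.
rewrite cd /disc_reflect; case: ifP => _.
  by rewrite normcV fmorphV /= {1}zc rmorphXn /= expr2; field.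
have -> : (normc z^*%R)%:C = (normc z)%:C by rewrite -!normr_normc norm_conjC.
by field.
Qed.

Lemma normc_disc_reflect_le1 z : normc (disc_reflect z) <= 1.
Proof. by rewrite -lecR; exact: normr_disc_reflect_le1. Qed.

Lemma normc_disc_reflect_gt0 z : z != 0 -> 0 < normc (disc_reflect z).
Proof.
by rewrite normc_gt0 /disc_reflect => ?; case: ifP; rewrite ?invr_eq0 ?conjC_eq0.
Qed.

Lemma normc_sum_conj (I : Type) (r : seq I) (f : I -> R[i]) :
  normc (\sum_(i <- r) f i) = normc (\sum_(i <- r) (f i)^*%R).
Proof. by apply: complexI; rewrite -!normr_normc -rmorph_sum norm_conjC. Qed.

(** Bernoulli's inequality. *)
Lemma one_sub_exprn_le (x : R) m : 0 <= x <= 1 -> 1 - x ^+ m <= m%:R * (1 - x).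
Proof.
move=> /andP[x0 x1]; elim: m => [|m IH]; first by rewrite expr0 subrr mul0r.
have xm0 : 0 <= x ^+ m by rewrite exprn_ge0.
have xm1 : x ^+ m <= 1 by rewrite exprn_ile1.
rewrite exprS -natr1; nra.
Qed.

(** The m-th powers of a reflection and of the conjugate direction differ by 1 - |a|^m in modulus,
    at most m (1 - |a|). Conjugating the whole sum aligns the arguments. *)
Lemma normc_sum_direction_le zs m : {in zs, forall z, z != 0} ->
  normc (\sum_(z <- zs) direction z ^+ m) <=
  normc (\sum_(z <- zs) disc_reflect z ^+ m) +
    m%:R * \sum_(z <- zs) (1 - normc (disc_reflect z)).
Proof.
move=> z0; rewrite normc_sum_conj.
rewrite -[X in normc X](subrK (\sum_(z <- zs) disc_reflect z ^+ m)) addrC.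
rewrite (le_trans (le_normcD _ _))// lerD2l -sumrB.
rewrite (le_trans (le_normc_sum _ _))// mulr_sumr.
rewrite big_seq [leRHS]big_seq; apply: ler_sum => z /z0 z0'.
have -> : disc_reflect z ^+ m =
    (normc (disc_reflect z))%:C ^+ m * ((direction z)^*%R) ^+ m.
  by rewrite {1}(disc_reflectE z0') exprMn.
rewrite rmorphXn /= -{1}[_ ^+ m]mul1r -mulrBl.
have -> : 1 - (normc (disc_reflect z))%:C ^+ m =
    (1 - normc (disc_reflect z) ^+ m)%:C by rewrite rmorphB rmorphXn.
rewrite normcM normcX; have -> : normc (direction z)^*%R = 1.
  by apply: complexI; rewrite -normr_normc norm_conjC normr_normc normc_direction.
rewrite expr1n mulr1 normcR.
have r01 : 0 <= normc (disc_reflect z) <= 1.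
  by rewrite normc_ge0 normc_disc_reflect_le1.
by rewrite ger0_norm ?one_sub_exprn_le// subr_ge0 exprn_ile1 ?normc_ge0//; case/andP: r01.
Qed.

(** The parameter t stays free: it is fixed first to make 5 t N a small fraction of N, after which
    the logarithm divided by t is o(N) as N grows. *)
Lemma roots_equidistribution_bounds zs (H e : R) (N := size zs) :
  (forall j, normc (\prod_(z <- zs) ('X - z%:P))`_j <= H) ->
  0 < e <= normc (\prod_(z <- zs) ('X - z%:P))`_0 ->
  [/\ {in zs, forall z, z != 0},
   \sum_(z <- zs) (1 - normc (disc_reflect z)) <= ln ((N.+1%:R * H) ^+ 2 / e) &
   forall m t, (0 < m)%N -> 0 < t <= 8^-1 ->
     normc (\sum_(z <- zs) disc_reflect z ^+ m) <=
     m%:R * ln (N.+1%:R ^+ 2 * H) / t + 5 * t * N%:R].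
Proof.
move=> pH /andP[e0 ep0].
have z0 : {in zs, forall z, z != 0}.
  move=> z zzs; apply/eqP => E; move: ep0.
  rewrite -horner_coef0 horner_prod (big_rem z)//= hornerXsubC E subrr mul0r normc0.
  by move=> /(lt_le_trans e0); rewrite ltxx.
have [B0 P0] : (forall x, normc x <= 1 ->
     \prod_(z <- zs) normc (1 - disc_reflect z * x) <= N.+1%:R ^+ 2 * H) /\
   normc (\prod_(z <- zs) ('X - z%:P))`_0 <=
     (N.+1%:R * H) ^+ 2 * \prod_(z <- zs) normc (disc_reflect z).
  have [|B0 P0] := @reflected_roots_bound _ zs H%:C.
    by move=> j; rewrite normr_normc lecR.
  split=> [x x1|].
    have := B0 x; rewrite normr_normc lecR => /(_ x1).
    by rewrite -lecR rmorph_prod rmorphM rmorphXn rmorph_nat.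
  by move: P0; rewrite -lecR rmorphM rmorphXn rmorphM rmorph_nat rmorph_prod.
have H0 : 0 < H by apply: lt_le_trans (pH 0); exact: lt_le_trans ep0.
have NH0 : 0 < (N.+1%:R * H) ^+ 2 by rewrite exprn_gt0// mulr_gt0.
split => //.
  rewrite -[leLHS](big_map (fun z => normc (disc_reflect z)) xpredT (fun a => 1 - a)).
  have -> : ln ((N.+1%:R * H) ^+ 2 / e) = - ln (e / (N.+1%:R * H) ^+ 2).
    (* The bound on |p(0)| reads e / ((N + 1) H)^2 <= product of the |a|, so the quotient is
       inverted under the logarithm. *)
    by rewrite -lnV ?posrE ?divr_gt0// invf_div.
  apply: sum_one_sub_le_ln; first by rewrite divr_gt0.
    by move=> _ /mapP[z /z0 zz ->]; exact: normc_disc_reflect_gt0.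
  by rewrite big_map ler_pdivrMr// mulrC (le_trans ep0).
move=> m t m0 /[dup] t8 /andP[t0 _].
have key : t * normc (\sum_(a <- [seq disc_reflect z ^+ m | z <- zs]) a) <=
   ln ((N.+1%:R ^+ 2 * H) ^+ m) + 5 * t ^+ 2 * N%:R.
  rewrite /N -(size_map (fun z => disc_reflect z ^+ m)).
  apply: normc_sum_le_ln => // [_ /mapP[z zzs ->]|x x1].
    by rewrite normcX exprn_ile1 ?normc_ge0 ?normc_disc_reflect_le1.
  rewrite size_map big_map -lecR rmorph_prod rmorphXn.
  apply: (@prod_one_sub_pow_le _ _ zs (@disc_reflect _)) => // [y|]; last by rewrite normr_normc lecR.
  by rewrite normr_normc lecR => /B0; rewrite -lecR rmorph_prod.
rewrite big_map lnXn ?mulr_gt0 ?exprn_gt0// -[_ *+ m]mulr_natl in key.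
rewrite -(ler_pM2l t0) (le_trans key)// le_eqVlt; apply/orP; left; apply/eqP.
by field; rewrite gt_eqF.
Qed.

End PowerSums.

(** * Complex random variables *)

Section BorelC.
Variable R : realType.

Lemma lipschitz1_continuousC (f : R[i]^o -> R) :
  (forall x y, `|f x - f y| <= normc (x - y)) -> continuous f.
Proof.
move=> lf x; apply/(@cvgrPdist_lt _ _ _ _ (nbhs_filter x)) => e e0.
apply/(@nbhs_ballP _ R[i]^o); exists e%:C => [|y]; first by rewrite /= ltcR.
by rewrite /ball /= => xy; rewrite (le_lt_trans (lf _ _))// -ltcR.
Qed.

Lemma continuous_Re : continuous (@complex.Re R : R[i]^o -> R).
Proof.
apply: lipschitz1_continuousC => x y; rewrite (le_trans _ (ler_Re_normc _))//.
by case: x y => [a b] [c d].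
Qed.

Lemma continuous_Im : continuous (@complex.Im R : R[i]^o -> R).
Proof.
apply: lipschitz1_continuousC => -[a b] [c d] /=.
rewrite -[leLHS]ger0_norm// -sqrtr_sqr ler_wsqrtr// real_normK ?num_real//.
by rewrite lerDr sqr_ge0.
Qed.

Lemma continuous_normc : continuous (@normc R : R[i]^o -> R).
Proof.
apply: lipschitz1_continuousC => x y; rewrite ler_norml; apply/andP; split.
  rewrite lerNl opprB lerBlDr -(normcN (x - y)) opprB.
  by rewrite -{1}[y](subrK x) le_normcD.
by rewrite lerBlDr -{1}[x](subrK y) le_normcD.
Qed.

Lemma continuous_measurable_funC (f : R[i]^o -> R) :
  continuous f -> measurable_fun setT (f : borelC R -> R).
Proof.
move=> cf; apply: (measurability _ (RGenOInfty.measurableE R)) => //.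
move=> _ [_ [x ->] <-]; rewrite setTI; apply: sub_sigma_algebra.
by apply: open_comp => // ? _; exact: cf.
Qed.

Lemma measurable_Re : measurable_fun setT (@complex.Re R : borelC R -> R).
Proof. exact: continuous_measurable_funC continuous_Re. Qed.

Lemma measurable_Im : measurable_fun setT (@complex.Im R : borelC R -> R).
Proof. exact: continuous_measurable_funC continuous_Im. Qed.

Lemma measurable_normc : measurable_fun setT (@normc R : borelC R -> R).
Proof. exact: continuous_measurable_funC continuous_normc. Qed.

End BorelC.

(* Measurability of a complex function through its real and imaginary parts,
   so that it passes through sums and products without a product sigma-algebra. *)
Definition measurable_funC d (T : measurableType d) (R : realType)
    (f : T -> R[i]) : Prop :=
  measurable_fun setT (fun x => complex.Re (f x)) /\
  measurable_fun setT (fun x => complex.Im (f x)).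

Section MeasurableFunC.
Context d (T : measurableType d) (R : realType).
Implicit Types f g : T -> R[i].

Lemma measurable_funC_cst (c : R[i]) : measurable_funC (fun _ : T => c).
Proof. by split; exact: measurable_cst. Qed.

Lemma measurable_funC_comp (f : T -> borelC R) :
  measurable_fun setT f -> measurable_funC (f : T -> R[i]).
Proof.
move=> mf; split; apply: measurableT_comp mf; first exact: measurable_Re.
exact: measurable_Im.
Qed.

Lemma measurable_funCD f g : measurable_funC f -> measurable_funC g ->
  measurable_funC (fun x => f x + g x).
Proof.
move=> [f1 f2] [g1 g2]; split.
  rewrite [X in measurable_fun _ X](_ : _ = (fun x => complex.Re (f x) + complex.Re (g x))).
    exact: measurable_funD.
  by apply/funext => x; case: (f x) (g x) => [a b] [c e].
rewrite [X in measurable_fun _ X](_ : _ = (fun x => complex.Im (f x) + complex.Im (g x))).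
  exact: measurable_funD.
by apply/funext => x; case: (f x) (g x) => [a b] [c e].
Qed.

Lemma measurable_funCM f g : measurable_funC f -> measurable_funC g ->
  measurable_funC (fun x => f x * g x).
Proof.
move=> [f1 f2] [g1 g2]; split.
  rewrite [X in measurable_fun _ X](_ : _ = (fun x =>
    complex.Re (f x) * complex.Re (g x) - complex.Im (f x) * complex.Im (g x))).
    by apply: measurable_funB; exact: measurable_funM.
  by apply/funext => x; case: (f x) (g x) => [a b] [c e].
rewrite [X in measurable_fun _ X](_ : _ = (fun x =>
  complex.Re (f x) * complex.Im (g x) + complex.Im (f x) * complex.Re (g x))).
  by apply: measurable_funD; exact: measurable_funM.
by apply/funext => x; case: (f x) (g x) => [a b] [c e].
Qed.

Lemma measurable_funC_sum (I : Type) (r : seq I) (f : I -> T -> R[i]) :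
  (forall i, measurable_funC (f i)) ->
  measurable_funC (fun x => \sum_(i <- r) f i x).
Proof.
move=> mf; elim: r => [|i r IH].
  rewrite (_ : (fun x => _) = (fun=> 0)); first exact: measurable_funC_cst.
  by apply/funext => x; rewrite big_nil.
rewrite (_ : (fun x => _) = (fun x => f i x + \sum_(j <- r) f j x)).
  exact: measurable_funCD.
by apply/funext => x; rewrite big_cons.
Qed.

Lemma measurable_funC_prod (I : Type) (r : seq I) (f : I -> T -> R[i]) :
  (forall i, measurable_funC (f i)) ->
  measurable_funC (fun x => \prod_(i <- r) f i x).
Proof.
move=> mf; elim: r => [|i r IH].
  rewrite (_ : (fun x => _) = (fun=> 1)); first exact: measurable_funC_cst.
  by apply/funext => x; rewrite big_nil.
rewrite (_ : (fun x => _) = (fun x => f i x * \prod_(j <- r) f j x)).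
  exact: measurable_funCM.
by apply/funext => x; rewrite big_cons.
Qed.

Lemma measurable_funC_det n (G : 'I_n -> 'I_n -> T -> R[i]) :
  (forall a b, measurable_funC (G a b)) ->
  measurable_funC (fun x => \det (\matrix_(a, b) G a b x)).
Proof.
move=> mG; apply: measurable_funC_sum => s.
apply: measurable_funCM; first exact: measurable_funC_cst.
apply: measurable_funC_prod => a.
rewrite (_ : (fun x => _) = G a (s a)) //.
by apply/funext => x; rewrite mxE.
Qed.

Lemma measurable_normcC f : measurable_funC f ->
  measurable_fun setT (fun x => normc (f x)).
Proof.
move=> [f1 f2]; rewrite [X in measurable_fun _ X](_ : _ =
    (fun x => Num.sqrt (complex.Re (f x) ^+ 2 + complex.Im (f x) ^+ 2))).
  apply: (measurableT_comp (continuous_measurable_fun (@sqrt_continuous R))).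
  by apply: measurable_funD; exact: measurable_funX.
by apply/funext => x; case: (f x).
Qed.

End MeasurableFunC.

(** * Small ball estimates *)

Section Independence.
Context d d' (Om : measurableType d) (T' : measurableType d') (R : realType)
  (P : probability Om R) (I : choiceType) (X : I -> Om -> T').
Hypothesis mX : forall i, measurable_fun setT (X i).
Hypothesis indep : mutually_independent P X.
Variable i0 : I.

(** A pi-system generating the sigma-algebra of the variables other than [X i0]. Measurability for
    this sigma-algebra expresses that a quantity is a function of those variables, without any joint
    law. *)
Definition other_cylinders : set (set Om) :=
  [set B | exists J : {fset I}, exists A : I -> set T',
    [/\ i0 \notin J, (forall i, measurable (A i)) &
        B = \bigcap_(i in [set` J]) X i @^-1` A i]].

Lemma measurable_cylinder (J : {fset I}) (A : I -> set T') :
  (forall i, measurable (A i)) ->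
  measurable (\bigcap_(i in [set` J]) X i @^-1` A i).
Proof.
move=> mA; apply: fin_bigcap_measurable => // i _.
by rewrite -[X in measurable X]setTI; exact: mX.
Qed.

Lemma setI_closed_other_cylinders : setI_closed other_cylinders.
Proof.
move=> _ _ [J1 [A1 [i1 mA1 ->]]] [J2 [A2 [i2 mA2 ->]]].
(* An index missing from one of the two families imposes no condition there, hence the default
   [setT]. *)
exists (J1 `|` J2)%fset, (fun i => (if i \in J1 then A1 i else setT) `&`
  (if i \in J2 then A2 i else setT)); split.
- by rewrite inE negb_or i1.
- by move=> i; apply: measurableI; case: ifP.
apply/seteqP; split=> [w [h1 h2] i /=|w h].
  by rewrite inE => _; split; case: ifP => //; [exact: h1|exact: h2].
split=> i /= iJ; have := h i; rewrite /= inE iJ ?orbT => /(_ erefl) [] //.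
Qed.

Lemma sub_other_cylinders_measurable : <<s other_cylinders >> `<=` measurable.
Proof.
apply: smallest_sub; first exact: sigma_algebra_measurable.
by move=> _ [J [A [_ mA ->]]]; exact: measurable_cylinder.
Qed.

(** As functions of B, both sides are finite measures: P restricted to the event on [X i0], and P
    scaled by the probability of that event. They agree on the pi-system, hence on what it
    generates. *)
Lemma independent_other_cylinders A0 B : measurable A0 ->
  <<s other_cylinders >> B ->
  P (X i0 @^-1` A0 `&` B) = (P (X i0 @^-1` A0) * P B)%E.
Proof.
move=> mA0 sB.
have mX0 : measurable (X i0 @^-1` A0).
  by rewrite -[X in measurable X]setTI; exact: mX.
pose c : {nonneg R} := NngNum (fine_ge0 (measure_ge0 P (X i0 @^-1` A0))).
have cE : (c%:num)%:E = P (X i0 @^-1` A0) by rewrite /= fineK// fin_num_measure.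
have -> : P (X i0 @^-1` A0 `&` B) = mrestr P mX0 B by rewrite /mrestr setIC.
have -> : (P (X i0 @^-1` A0) * P B)%E = mscale c P B by rewrite -cE.
apply: (g_sigma_algebra_measure_unique other_cylinders _ (fun=> setT)) => //.
- by move=> C GC; apply: sub_other_cylinders_measurable; exact: sub_sigma_algebra.
- move=> _; exists fset0, (fun=> setT); split => //.
  by apply/seteqP; split.
- by rewrite bigcup_const.
- exact: setI_closed_other_cylinders.
- move=> _ [J [A [i0J mA ->]]]; rewrite -[RHS]/(c%:num%:E * P (\bigcap_(i in [set` J]) X i @^-1` A i))%E.
  rewrite cE indep//.
  rewrite -[LHS]/(P (\bigcap_(i in [set` J]) X i @^-1` A i `&` X i0 @^-1` A0)).
  (* The condition on [X i0] is inserted at [i0], which is outside [J]; independence then applies to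
     the enlarged index set. *)
  pose A' i := if i == i0 then A0 else A i.
  have mA' i : measurable (A' i) by rewrite /A'; case: ifP.
  have -> : \bigcap_(i in [set` J]) X i @^-1` A i `&` X i0 @^-1` A0 =
      \bigcap_(i in [set` (i0 |` J)%fset]) X i @^-1` A' i.
    apply/seteqP; split=> [w [h1 h2] i /=|w h].
      rewrite in_fset1U /A'; case: eqVneq => [->//|_ /= iJ]; exact: h1.
    split=> [i /= iJ|].
      have := h i; rewrite /= in_fset1U iJ orbT /A' => /(_ erefl).
      by case: eqVneq => // E; move: i0J; rewrite -E iJ.
    by have := h i0; rewrite /= in_fset1U eqxx /A' eqxx; exact.
  rewrite indep// big_fsetU1//= /A' eqxx; congr (_ * _)%E.
  apply: eq_big_seq => i iJ; case: eqVneq => // E.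
  by move: i0J; rewrite -E iJ.
- move=> _; rewrite -[X in (X < _)%E]/(P (setT `&` X i0 @^-1` A0)) setTI.
  by rewrite (le_lt_trans (probability_le1 P mX0))// ltry.
Qed.

End Independence.

Lemma measurable_fun_other_cylinders d d' (Om : measurableType d)
    (T' : measurableType d') (I : choiceType) (X : I -> Om -> T') (i0 i : I) :
  i != i0 ->
  measurable_fun setT (X i : g_sigma_algebraType (other_cylinders X i0) -> T').
Proof.
move=> ii0 _ Y mY; rewrite setTI; apply: sub_sigma_algebra.
exists [fset i]%fset, (fun=> Y); split => //; first by rewrite inE eq_sym.
apply/seteqP; split=> [w h j /=|w /(_ i)]; first by rewrite inE => /eqP ->.
by rewrite /= inE eqxx => /(_ erefl).
Qed.

(** The integer cells are numbered by [pickle] to give a partition indexed by nat, as countable sums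
    require; a number that codes no integer gives the empty cell. *)
Lemma measurable_preimage_floor d (T : measurableType d) (R : realType)
    (c : T -> R) (n : nat) : measurable_fun setT c ->
  measurable [set w | choice.pickle (Num.floor (c w)) = n].
Proof.
move=> mc; have [[j jn]|nj] := pselect (exists j : int, choice.pickle j = n).
  rewrite (_ : [set _ | _] = setT `&` c @^-1` `[j%:~R, (j + 1)%:~R[%classic).
    by apply: mc => //; exact: measurable_itv.
  rewrite setTI; apply/seteqP; split=> w /=.
    rewrite -jn => /(pcan_inj choice.pickleK) <-; rewrite in_itv /=.
    exact: floor_itv.
  by rewrite in_itv /= => h; rewrite (floor_def h).
rewrite (_ : [set _ | _] = set0)//; apply/seteqP; split => // w /= wn.
by apply: nj; exists (Num.floor (c w)).
Qed.

(** The fraction is Re (S / D), spelled out in real terms so that its measurability reduces to that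
    of real functions. Divide |g D + S| < e^2 by |D| >= e. *)
Lemma Re_near_quotient (R : realType) (g D S : R[i]) (e : R) : 0 < e ->
  normc (g * D + S) < e ^+ 2 -> e <= normc D ->
  `|complex.Re g + (complex.Re S * complex.Re D + complex.Im S * complex.Im D)
     / normc D ^+ 2| < e.
Proof.
move=> e0 he eD; have D0 : 0 < normc D by exact: lt_le_trans eD.
have Dn0 : D != 0 by rewrite -normc_gt0.
have -> : complex.Re g + (complex.Re S * complex.Re D + complex.Im S * complex.Im D)
     / normc D ^+ 2 = complex.Re ((g * D + S) / D).
  rewrite [in RHS]mulrDl mulfK// sqr_normcE; case: g S D {he eD D0 Dn0} => [a b] [s t] [x y] /=.
  by rewrite mulrN opprK mulrDl !mulrA.
rewrite (le_lt_trans (ler_Re_normc _))// normcM normcV ltr_pdivrMr//.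
by rewrite (lt_le_trans he)// expr2 ler_pM2l.
Qed.

Section SmallBall.
Context d (Om : measurableType d) (R : realType) (P : probability Om R)
  (I : choiceType) (X : I -> Om -> borelC R).
Hypothesis mX : forall i, measurable_fun setT (X i).
Hypothesis indep : mutually_independent P X.

Lemma measurable_fun_sub_other i0 (f : Om -> R) :
  measurable_fun setT (f : g_sigma_algebraType (other_cylinders X i0) -> R) ->
  measurable_fun setT f.
Proof.
move=> mf _ Y mY; apply: (sub_other_cylinders_measurable mX (i0 := i0)).
exact: mf.
Qed.

Lemma measurable_funC_sub_other i0 (f : Om -> R[i]) :
  measurable_funC (f : g_sigma_algebraType (other_cylinders X i0) -> R[i]) ->
  measurable_funC f.
Proof. by move=> [f1 f2]; split; exact: (@measurable_fun_sub_other i0). Qed.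

Variables (i0 : I) (K : R).
Hypothesis X_strip : forall x h, 0 < h ->
  (P (X i0 @^-1` [set z : borelC R | (x < complex.Re z < x + h)%R]) <= (K * h)%:E)%E.

(* Partition according to the cell of Re (- S / D) in a grid of step e: on each
   cell X i0 is confined to a strip of width 3 e. *)
Lemma small_ball_affine (D S : Om -> R[i]) (e : R) : 0 < e -> 0 <= K ->
  measurable_funC (D : g_sigma_algebraType (other_cylinders X i0) -> R[i]) ->
  measurable_funC (S : g_sigma_algebraType (other_cylinders X i0) -> R[i]) ->
  (P [set w | (normc (X i0 w * D w + S w) < e ^+ 2)%R] <=
   P [set w | (normc (D w) < e)%R] + (K * (3 * e))%:E)%E.
Proof.
move=> e0 K0 mD mS.
set E1 := [set w | _]; set E2 := [set w | (_ < e)%R].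
have mlt (f : Om -> R[i]) (a : R) : measurable_funC f ->
    measurable [set w | normc (f w) < a].
  move=> mf; rewrite (_ : [set _ | _] = setT `&` (fun w => normc (f w)) @^-1` `]-oo, a[%classic).
    by apply: (measurable_normcC mf) => //; exact: measurable_itv.
  by rewrite setTI; apply/seteqP; split=> w /=; rewrite in_itv.
have mE2 : measurable E2 by apply: mlt; exact: measurable_funC_sub_other mD.
have mE1 : measurable E1.
  apply: mlt; apply: measurable_funCD; last exact: measurable_funC_sub_other mS.
  apply: measurable_funCM; last exact: measurable_funC_sub_other mD.
  exact: measurable_funC_comp.
(* This is - Re (S / D) in units of e; the reciprocal is written as a real power so that
   [measurable_powR] applies. *)
pose c w := - ((complex.Re (S w) * complex.Re (D w) + complex.Im (S w) * complex.Im (D w))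
     * (normc (D w) ^+ 2) `^ (-1)) / e.
have mc : measurable_fun setT (c : g_sigma_algebraType (other_cylinders X i0) -> R).
  apply: measurable_funM => //; apply: measurableT_comp => //.
  apply: measurable_funM.
    by apply: measurable_funD; apply: measurable_funM; [case: mS|case: mD|case: mS|case: mD].
  have mD2 : measurable_fun setT
      ((fun w => normc (D w) ^+ 2) : g_sigma_algebraType (other_cylinders X i0) -> R).
    by apply: measurable_funX; exact: measurable_normcC.
  exact: (measurableT_comp (measurable_powR (-1)) mD2).
pose F n := [set w | choice.pickle (Num.floor (c w)) = n].
have sF n : <<s other_cylinders X i0 >> (F n) by exact: measurable_preimage_floor mc.
have mF n : measurable (F n) by exact: sub_other_cylinders_measurable (sF n).
(* On the cell j e <= c e < (j + 1) e, the real part of [X i0] is within e of c e, hence in the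
   strip from (j - 1) e to (j + 2) e. The default 0 is harmless: if n codes no integer then [F n] is
   empty. *)
pose W n : set (borelC R) := [set z : borelC R |
  (((odflt 0 (choice.unpickle n))%:~R - 1) * e < complex.Re z <
   ((odflt 0 (choice.unpickle n))%:~R - 1) * e + 3 * e)%R].
have mW n : measurable (W n).
  rewrite (_ : W n = setT `&` @complex.Re R @^-1` `]((odflt 0 (choice.unpickle n))%:~R - 1) * e,
   ((odflt 0 (choice.unpickle n))%:~R - 1) * e + 3 * e[%classic).
    by apply: measurable_Re => //; exact: measurable_itv.
  by rewrite setTI; apply/seteqP; split=> z; rewrite /W /= in_itv.
have mXW n : measurable (X i0 @^-1` W n).
  by rewrite -[X in measurable X]setTI; exact: mX.
have cover : E1 `\` E2 `<=` \bigcup_n (X i0 @^-1` W n `&` F n).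
  move=> w [/= h1 /negP]; rewrite -leNgt => h2.
  exists (choice.pickle (Num.floor (c w))) => //; split => //.
  rewrite /W /= choice.pickleK /=.
  have := Re_near_quotient e0 h1 h2.
  have -> : (complex.Re (S w) * complex.Re (D w) + complex.Im (S w) * complex.Im (D w)) /
    normc (D w) ^+ 2 = - (c w * e).
    by rewrite /c divfK ?gt_eqF// opprK powR_inv1// exprn_ge0// normc_ge0.
  have /andP[] := floor_itv (c w); rewrite intrD /=.
  rewrite -(ler_pM2r e0) -(ltr_pM2r e0) ltr_norml => f1 f2 /andP[g1 g2].
  by apply/andP; split; nra.
have trivF : trivIset setT F.
  apply/trivIsetP => i j _ _ /eqP ij; apply/seteqP; split => // w [wi wj].
  by apply: ij; exact: etrans (esym wi) wj.
apply: (@le_trans _ _ (P E2 + P (E1 `\` E2))%E).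
  apply: (@le_trans _ _ (P (E2 `|` (E1 `\` E2)))).
    apply: le_measure; rewrite ?inE//.
      by apply: measurableU => //; exact: measurableD.
    by move=> w E1w; have [E2w|nE2w] := pselect (E2 w); [left|right].
  by apply: measureU2 => //; exact: measurableD.
rewrite leeD2l//; apply: (@le_trans _ _ (\sum_(n <oo) P (X i0 @^-1` W n `&` F n))%E).
  apply: measure_sigma_subadditive => //; last exact: measurableD.
  by move=> n; exact: measurableI.
(* The cell [F n] depends on the other variables only, so each term factors; the cells are disjoint,
   so the total mass is at most 1. *)
apply: (@le_trans _ _ (\sum_(n <oo) (K * (3 * e))%:E * P (F n))%E).
  apply: lee_nneseries => // n _; rewrite (independent_other_cylinders mX indep)//.
  by rewrite lee_wpmul2r// X_strip// mulr_gt0.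
rewrite nneseriesZl// -measure_semi_bigcup//; last exact: bigcup_measurable.
rewrite -[leRHS]mule1 lee_wpmul2l//.
  by rewrite lee_fin mulr_ge0// mulr_ge0// ltW.
by apply: probability_le1; exact: bigcup_measurable.
Qed.

End SmallBall.

Section SmallBallDet.
Context d (Om : measurableType d) (R : realType) (P : probability Om R)
  (I : choiceType) (X : I -> Om -> borelC R).
Hypothesis mX : forall i, measurable_fun setT (X i).
Hypothesis indep : mutually_independent P X.
Variable K : R.
Hypothesis K0 : 0 <= K.
Hypothesis X_strip : forall i x h, 0 < h ->
  (P (X i @^-1` [set z : borelC R | (x < complex.Re z < x + h)%R]) <= (K * h)%:E)%E.

(** Injectivity of [u] makes the entries distinct members of the independent family, so that the
    first one is independent of all the others. *)
Lemma small_ball_det n (u : 'I_n -> 'I_n -> I) (e : R) :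
  (forall a b a' b', u a b = u a' b' -> a = a' /\ b = b') -> 0 < e <= 1 ->
  (P [set w | (normc (\det (\matrix_(a < n, b < n) (X (u a b) w : R[i]))) <
       e ^+ (2 ^ n))%R] <= (n%:R * (K * (3 * e)))%:E)%E.
Proof.
move=> uinj /andP[e0 e1]; elim: n u uinj => [|n IH] u uinj.
  rewrite (_ : [set _ | _] = set0) ?measure0 ?mul0r//.
  apply/seteqP; split => // w /=.
  by rewrite det_mx00 normc1 expr1 ltNge e1.
pose G w := \matrix_(a < n.+1, b < n.+1) (X (u a b) w : R[i]).
pose D w := cofactor (G w) ord0 ord0.
pose S w := \sum_(j < n) G w ord0 (lift ord0 j) * cofactor (G w) ord0 (lift ord0 j).
set i0 := u ord0 ord0.
pose TG := g_sigma_algebraType (other_cylinders X i0).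
(* Expand along row 0: D is the cofactor of the corner entry and S collects the other terms. Neither
   involves the corner. *)
have mXi a b : (a, b) != (ord0, ord0) -> measurable_funC (X (u a b) : TG -> R[i]).
  move=> ab; apply: measurable_funC_comp; apply: measurable_fun_other_cylinders.
  by apply: contra ab => /eqP/uinj[-> ->].
have mcof j : measurable_funC ((fun w => cofactor (G w) ord0 j) : TG -> R[i]).
  apply: measurable_funCM; first exact: measurable_funC_cst.
  rewrite (_ : (fun w => _) = (fun w => \det (\matrix_(a < n, b < n)
      (X (u (lift ord0 a) (lift j b)) w : R[i])))).
    by apply: (@measurable_funC_det _ TG) => a b; apply: mXi; rewrite xpair_eqE [_ == ord0]eq_sym (negbTE (neq_lift _ _)).
  by apply/funext => w; congr (\det _); apply/matrixP => a b; rewrite !mxE.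
have mD : measurable_funC (D : TG -> R[i]) by exact: mcof.
have mS : measurable_funC (S : TG -> R[i]).
  apply: measurable_funC_sum => j; apply: measurable_funCM; last exact: mcof.
  rewrite (_ : (fun w => _) = X (u ord0 (lift ord0 j))).
    by apply: mXi; rewrite xpair_eqE eqxx [_ == ord0]eq_sym (negbTE (neq_lift _ _)).
  by apply/funext => w; rewrite mxE.
have ek0 : 0 < e ^+ (2 ^ n) by rewrite exprn_gt0.
have := @small_ball_affine _ Om R P I X mX indep i0 K (X_strip i0) D S _ ek0 K0 mD mS.
rewrite (_ : [set w | (normc (X i0 w * D w + S w) < _)%R] = [set w |
   normc (\det (G w)) < e ^+ (2 ^ n.+1)]); last first.
  apply/seteqP; split=> w /=;
  by rewrite (expand_det_row _ ord0) big_ord_recl {1}mxE -exprM expnSr.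
rewrite (_ : [set w | (normc (D w) < _)%R] = [set w |
   normc (\det (\matrix_(a < n, b < n) (X (u (lift ord0 a) (lift ord0 b)) w : R[i])))
     < e ^+ (2 ^ n)]); last first.
  suff DE w : D w = \det (\matrix_(a < n, b < n)
      (X (u (lift ord0 a) (lift ord0 b)) w : R[i])).
    by apply/seteqP; split=> w /=; rewrite DE.
  rewrite /D /cofactor addn0 expr0 mul1r; congr (\det _).
  by apply/matrixP => a b; rewrite !mxE.
move=> /le_trans; apply.
rewrite -[n.+1%:R]natr1 [(_ + 1) * _]mulrDl mul1r EFinD leeD//.
  by apply: IH => a b a' b' /uinj [/lift_inj -> /lift_inj ->].
(* The affine estimate was used at scale e^(2^n), which is at most e because e <= 1. *)
rewrite lee_fin ler_wpM2l// ler_pM2l// -[leRHS]expr1 ler_wiXn2l// ?ltW//.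
by rewrite expn_gt0.
Qed.

End SmallBallDet.

(** * Gaussian estimates *)

Section Normal.
Variable R : realType.
Local Notation mu := (@lebesgue_measure R).

Lemma normal_prob_itv_le (m s x h : R) : s != 0 -> 0 < h ->
  (normal_prob m s `]x, (x + h)%R[ <= (normal_peak s * h)%:E)%E.
Proof.
move=> s0 h0; rewrite /normal_prob.
apply: (@le_trans _ _ (\int[mu]_(y in `]x, (x + h)%R[) (normal_peak s)%:E)%E).
  apply: ge0_le_integral => //.
  - by move=> y _; rewrite lee_fin normal_pdf_ge0.
  - by apply/measurable_EFinP/measurable_funTS; exact: measurable_normal_pdf.
  - by move=> y _; rewrite lee_fin normal_pdf_ub.
rewrite integral_cst//= lebesgue_measure_itv /= lte_fin ltrDl h0 -EFinB.
by rewrite addrAC subrr add0r -EFinM.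
Qed.

(* Compare with the normal density of twice the variance, of total mass 1. *)
Lemma normal_prob_tail_le (s t : R) : s != 0 -> 0 < t ->
  (normal_prob 0 s [set x | (t < `|x|)%R] <=
    (normal_peak s / normal_peak (Num.sqrt 2 * s) * (4 * s ^+ 2 / t ^+ 2))%:E)%E.
Proof.
move=> s0 t0; set s' := Num.sqrt 2 * s; set E := (X in normal_prob 0 s X).
have s'0 : s' != 0 by rewrite mulf_neq0// sqrtr_eq0 -ltNge.
set c := _ / _ * _.
have pk' := normal_peak_gt0 s'0; have pk := normal_peak_gt0 s0.
have s20 : 0 < s ^+ 2 by rewrite exprn_even_gt0.
have c0 : 0 <= c.
  apply: mulr_ge0; apply: divr_ge0; rewrite ?(ltW pk) ?(ltW pk') ?(sqr_ge0 t)//.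
  by rewrite pmulr_rge0// ltW.
have mE : measurable E.
  rewrite (_ : E = setT `&` (@Num.norm _ R) @^-1` `]t, +oo[%classic).
    by apply: normr_measurable => //; exact: measurable_itv.
  by rewrite setTI; apply/seteqP; split=> y /=; rewrite in_itv /= andbT.
have pdfle x : t < `|x| -> normal_pdf 0 s x <= c * normal_pdf 0 s' x.
  move=> tx; rewrite /normal_pdf (negbTE s0) (negbTE s'0) /normal_fun !subr0.
  have -> : c * (normal_peak s' * expR (- x ^+ 2 / (s' ^+ 2 *+ 2))) =
     normal_peak s * (4 * s ^+ 2 / t ^+ 2 * expR (- x ^+ 2 / (s' ^+ 2 *+ 2))).
    by rewrite /c; field; rewrite !gt_eqF.
  rewrite ler_pM2l//.
  (* The two exponents are - 2 y and - y, so the ratio of the exponentials is exp(- y) <= 1 / y <= 4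
     s^2 / t^2. *)
  set y := x ^+ 2 / (4 * s ^+ 2).
  have -> : - x ^+ 2 / (s ^+ 2 *+ 2) = - y + - y.
    by rewrite /y; field.
  have -> : - x ^+ 2 / (s' ^+ 2 *+ 2) = - y.
    by rewrite /y /s' exprMn sqr_sqrtr//; field.
  rewrite expRD ler_pM2r ?expR_gt0//.
  have y0 : 0 < y.
    apply: divr_gt0; last by rewrite mulr_gt0.
    by rewrite -[x ^+ 2]real_normK ?num_real// exprn_gt0// (lt_trans t0).
  rewrite expRN -[4 * s ^+ 2 / _]invrK invf_div lef_pV2 ?posrE ?expR_gt0 ?divr_gt0 ?(exprn_gt0 2 t0) ?(mulr_gt0 _ s20)//.
  apply: (@le_trans _ _ y).
    have tx2 : t ^+ 2 <= x ^+ 2.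
      by rewrite -[x ^+ 2]real_normK ?num_real//; apply: lerXn2r; rewrite ?nnegrE ?normr_ge0 ?ltW.
    by rewrite /y ler_wpM2r// invr_ge0 ltW// mulr_gt0.
  by rewrite (le_trans _ (expR_ge1Dx _))// lerDr.
rewrite /normal_prob.
apply: (@le_trans _ _ (\int[mu]_(x in E) (c%:E * (normal_pdf 0 s' x)%:E))%E).
  apply: ge0_le_integral => //.
  - by move=> y _; rewrite lee_fin normal_pdf_ge0.
  - by apply/measurable_EFinP/measurable_funTS; exact: measurable_normal_pdf.
  - apply/measurable_EFinP/measurable_funTS.
    by apply: measurable_funM => //; exact: measurable_normal_pdf.
rewrite ge0_integralZl//=; last 2 first.
- by apply/measurable_EFinP/measurable_funTS; exact: measurable_normal_pdf.
- by move=> y _; rewrite lee_fin normal_pdf_ge0.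
rewrite -[leRHS]mule1 lee_wpmul2l ?lee_fin//.
exact: (probability_le1 (normal_prob 0 s') mE).
Qed.

End Normal.

Lemma measure_bigsetU_le d (T : measurableType d) (R : realType)
    (m : {measure set T -> \bar R}) (I : Type) (r : seq I) (F : I -> set T) :
  (forall i, measurable (F i)) ->
  (m (\big[setU/set0]_(i <- r) F i) <= \sum_(i <- r) m (F i))%E.
Proof.
move=> mF; elim: r => [|i r IH]; first by rewrite !big_nil measure0.
rewrite !big_cons (le_trans (measureU2 _ _ _))//.
  exact: bigsetU_measurable.
by rewrite leeD2l.
Qed.

(** Telescoping: 1 / x^2 <= 2 (1 / x - 1 / (x + 1)) for x >= 1, so the partial sums stay below 2 c
    (1 - 1 / (N + 1)). *)
Lemma nneseries_inv_sqr_lty (R : realType) (u : (\bar R)^nat) (c : R) :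
  (forall k, 0 <= u k)%E -> (forall k, u k <= (c / k.+1%:R ^+ 2)%:E)%E ->
  (\sum_(k <oo) u k < +oo)%E.
Proof.
move=> u0 uc.
have c0 : 0 <= c.
  by have := le_trans (u0 0%N) (uc 0%N); rewrite lee_fin expr1n divr1.
apply: (@le_lt_trans _ _ (2 * c)%:E); last exact: ltry.
apply: lime_le; first exact: is_cvg_nneseries.
apply: nearW => N; rewrite big_mkord.
apply: (@le_trans _ _ (2 * c * (1 - N.+1%:R^-1))%:E); last first.
  by rewrite lee_fin ler_piMr ?mulr_ge0// gerBl invr_ge0.
elim: N => [|N IH]; first by rewrite big_ord0 invr1 subrr mulr0.
rewrite big_ord_recr /= (le_trans (leeD IH (uc N)))// -EFinD lee_fin.
rewrite -lerBrDl -mulrBr -[_ - _ - _]/(_ + - _ + - _) opprD opprK addrACA subrr add0r.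
rewrite [2 * c]mulrC -mulrA ler_wpM2l//.
have x0 : 0 < N.+1%:R :> R by [].
have x1 : 1 <= N.+1%:R :> R by rewrite ler1n.
rewrite -[N.+2%:R]natr1; move: (N.+1%:R) x0 x1 => x x0 x1.
have -> : 2 * (- (x + 1)^-1 + x^-1) = 2 / (x * (x + 1)).
  by field; rewrite !gt_eqF// addr_gt0.
rewrite -[leLHS]mul1r -subr_ge0.
have -> : 2 / (x * (x + 1)) - 1 * x ^- 2 = (x - 1) / (x ^+ 2 * (x + 1)).
  by field; rewrite !gt_eqF// addr_gt0.
by rewrite divr_ge0// ?subr_ge0// mulr_ge0 ?sqr_ge0// addr_ge0// ltW.
Qed.

Section StandardComplexNormal.
Context d (Om : measurableType d) (R : realType) (P : probability Om R).
Variable Z : {RV P >-> borelC R}.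
Hypothesis Z_normal : standard_complex_normal Z.
Local Notation s := (Num.sqrt 2^-1 : R).

Lemma sqrt_half_neq0 : s != 0.
Proof. by rewrite sqrtr_eq0 -ltNge. Qed.

Lemma normal_strip_le x h : 0 < h ->
  (P (Z @^-1` [set z : borelC R | (x < complex.Re z < x + h)%R]) <=
   (normal_peak s * h)%:E)%E.
Proof.
move=> h0; have [[mX lawX] _ _] := Z_normal.
have := lawX `]x, (x + h)[%classic (measurable_itv _).
rewrite (_ : _ @^-1` _ = Z @^-1` [set z : borelC R | (x < complex.Re z < x + h)%R]).
  by move=> ->; apply: normal_prob_itv_le => //; exact: sqrt_half_neq0.
by apply/seteqP; split=> w /=; rewrite in_itv.
Qed.

Lemma measurable_normc_gt (t : R) :
  measurable [set w | t < normc (Z w : R[i])].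
Proof.
rewrite (_ : [set _ | _] = setT `&` ((@normc R : borelC R -> R) \o Z) @^-1` `]t, +oo[%classic).
  by apply: (measurableT_comp (@measurable_normc R)) => //; exact: measurable_itv.
by rewrite setTI; apply/seteqP; split=> w /=; rewrite in_itv /= andbT.
Qed.

(** If |Z| > t, the real or the imaginary part exceeds t / 2 in modulus. Each of these two events
    contributes 4 s^2 / (t / 2)^2 = 8 / t^2 up to the ratio of peaks, hence 16. *)
Lemma normal_tail_le (t : R) : 0 < t ->
  (P [set w | (t < normc (Z w : R[i]))%R] <=
   (normal_peak s / normal_peak (Num.sqrt 2 * s) * 16 / t ^+ 2)%:E)%E.
Proof.
move=> t0; have [[mX lawX] [mY lawY] _] := Z_normal.
pose A : set R := [set x | t / 2 < `|x|].
have mA : measurable A.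
  rewrite (_ : A = setT `&` (@Num.norm _ R) @^-1` `](t / 2), +oo[%classic).
    by apply: normr_measurable => //; exact: measurable_itv.
  by rewrite setTI; apply/seteqP; split=> y /=; rewrite in_itv /= andbT.
have mf (f : Om -> R) : measurable_fun setT f -> measurable (f @^-1` A).
  by move=> mf; rewrite -[X in measurable X]setTI; exact: mf.
set X := (fun w => complex.Re (Z w)) in mX lawX.
set Y := (fun w => complex.Im (Z w)) in mY lawY.
apply: (@le_trans _ _ (P (X @^-1` A) + P (Y @^-1` A))%E).
  apply: (@le_trans _ _ (P (X @^-1` A `|` Y @^-1` A))).
    apply: le_measure; rewrite ?inE//.
    - exact: measurable_normc_gt.
    - by apply: measurableU; exact: mf.
    move=> w; rewrite /A /X /Y /=; case: (Z w) => a b /= tn.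
    have [|ta] := ltP (t / 2) `|a|; first by left.
    right; rewrite ltNge; apply/negP => tb; move: tn; apply/negP.
    rewrite -leNgt -(@ler_pXn2r _ 2) ?nnegrE ?sqrtr_ge0 ?(ltW t0)//.
    rewrite sqr_sqrtr ?addr_ge0 ?sqr_ge0// -[a ^+ 2]real_normK ?num_real//.
    rewrite -[b ^+ 2]real_normK ?num_real//.
    have := normr_ge0 a; have := normr_ge0 b; nra.
  by apply: measureU2; exact: mf.
rewrite lawX// lawY//.
have := normal_prob_tail_le sqrt_half_neq0 (divr_gt0 t0 (ltr0Sn R 1)).
rewrite sqr_sqrtr// => tl; apply: (le_trans (leeD tl tl)).
rewrite -EFinD lee_fin le_eqVlt; apply/orP; left; apply/eqP.
by field; rewrite !gt_eqF// normal_peak_gt0// mulf_neq0 ?sqrt_half_neq0// sqrtr_eq0 -ltNge.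
Qed.

End StandardComplexNormal.

(** * Almost sure polynomial bounds *)

Section BorelCantelli.
Context (R : realType) (d : measure_display)
    (Omega : measurableType d) (P : probability Omega R) (n : nat)
    (C : forall k : nat, 'I_k -> 'I_n -> 'I_n -> {RV P >-> borelC R}).
Hypothesis C_normal : forall k (j : 'I_k) (a b : 'I_n),
      standard_complex_normal (C j a b).
Hypothesis C_indep : mutually_independent P
      (fun i : {k : nat & ('I_k * 'I_n * 'I_n)%type} =>
         let: existT k (j, a, b) := i in C j a b : Omega -> borelC R).

(** The degree is k + 1, so that C_0 exists. With K = k + 1, the thresholds K^2 for the entries and
    e = K^-2 for the determinant make both failure probabilities O(K^-2), which is summable. *)
Lemma ae_eventually_entries_det_bounds :
  {ae P, forall w, exists k0, forall k, (k0 <= k)%N ->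
    (forall (j : 'I_k.+1) a b, normc (C j a b w : R[i]) <= k.+1%:R ^+ 2) /\
    (k.+1%:R ^- 2) ^+ (2 ^ n) <=
      normc (\det (\matrix_(a < n, b < n) (C (ord0 : 'I_k.+1) a b w : R[i])))}.
Proof.
set s : R := Num.sqrt 2^-1; set c1 := normal_peak s / normal_peak (Num.sqrt 2 * s) * 16.
pose X (i : {k : nat & ('I_k * 'I_n * 'I_n)%type}) : Omega -> borelC R :=
  let: existT k (j, a, b) := i in C j a b : Omega -> borelC R.
have mX i : measurable_fun setT (X i) by case: i => k [[j a] b].
have X_strip i x h : 0 < h ->
    (P (X i @^-1` [set z : borelC R | (x < complex.Re z < x + h)%R]) <=
      (normal_peak s * h)%:E)%E.
  by case: i => k [[j a] b]; exact: (normal_strip_le (C_normal j a b)).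
pose u k (a b : 'I_n) : {k : nat & ('I_k * 'I_n * 'I_n)%type} :=
  existT _ k.+1 (ord0, a, b).
have uinj k a b a' b' : u k a b = u k a' b' -> a = a' /\ b = b'.
  by move=> /eqP; rewrite -tag_eqE /tag_eq /= eqxx tagged_asE => /eqP[-> ->].
pose Ent k (i : 'I_k.+1 * 'I_n * 'I_n) :=
  [set w | k.+1%:R ^+ 2 < normc (C i.1.1 i.1.2 i.2 w : R[i])].
pose Det k := [set w | normc (\det (\matrix_(a < n, b < n) (X (u k a b) w : R[i]))) <
  (k.+1%:R ^- 2) ^+ (2 ^ n)].
pose F k := Det k `|` \big[setU/set0]_(i : 'I_k.+1 * 'I_n * 'I_n) Ent k i.
have mEnt k i : measurable (Ent k i) by exact: measurable_normc_gt.
have mDet k : measurable (Det k).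
  pose f w := normc (\det (\matrix_(a < n, b < n) (X (u k a b) w : R[i]))).
  have mf : measurable_fun setT f.
    by apply: measurable_normcC; apply: measurable_funC_det => a b;
      apply: measurable_funC_comp; exact: mX.
  rewrite (_ : Det k = setT `&` f @^-1` `]-oo, (k.+1%:R ^- 2) ^+ (2 ^ n)[%classic).
    by apply: mf => //; exact: measurable_itv.
  by rewrite setTI; apply/seteqP; split=> w; rewrite /Det /= in_itv.
have mF k : measurable (F k).
  by apply: measurableU => //; exact: bigsetU_measurable.
have peak0 : 0 < normal_peak s by rewrite normal_peak_gt0// sqrt_half_neq0.
have k2 k : 0 < k.+1%:R ^+ 2 :> R by rewrite exprn_gt0.
have PDet k : (P (Det k) <= (n%:R * (normal_peak s * 3) / k.+1%:R ^+ 2)%:E)%E.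
  have e01 : 0 < (k.+1%:R ^- 2 : R) <= 1.
    by rewrite invr_gt0 k2 invf_le1// exprn_ege1// ler1n.
  rewrite (le_trans (small_ball_det mX C_indep (ltW peak0) X_strip (@uinj k) e01))//.
  by rewrite lee_fin !mulrA.
have PEnt k : (P (\big[setU/set0]_(i : 'I_k.+1 * 'I_n * 'I_n) Ent k i) <=
    (n%:R ^+ 2 * c1 / k.+1%:R ^+ 2)%:E)%E.
  rewrite (le_trans (measure_bigsetU_le _ _ _))//.
  apply: (@le_trans _ _ (\sum_(i : 'I_k.+1 * 'I_n * 'I_n) (c1 / (k.+1%:R ^+ 2) ^+ 2)%:E)%E).
    by apply: lee_sum => i _; exact: (normal_tail_le (C_normal _ _ _) (k2 k)).
  rewrite sumEFin lee_fin sumr_const !card_prod !card_ord -[_ *+ _]mulr_natl.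
  rewrite !natrM.
  (* There are K n^2 entries with tail c1 / K^4 each; the spare factor 1 / K is then dropped. *)
  have -> : k.+1%:R * n%:R * n%:R * (c1 / k.+1%:R ^+ 2 ^+ 2) =
     n%:R ^+ 2 * c1 / k.+1%:R ^+ 2 * k.+1%:R^-1 by field; rewrite addrC natr1 pnatr_eq0.
  have c10 : 0 <= c1 by rewrite mulr_ge0// divr_ge0 ?normal_peak_ge0.
  rewrite ler_piMr//; last by rewrite invf_le1// ler1n.
  by rewrite divr_ge0 ?(ltW (k2 _))// mulr_ge0// sqr_ge0.
have PF0 : P (lim_sup_set F) = 0%E.
  apply: lim_sup_set_cvg0 => //.
  apply: (nneseries_inv_sqr_lty (c := n%:R * (normal_peak s * 3) + n%:R ^+ 2 * c1)) => // k.
  rewrite (le_trans (measureU2 _ _ _))//; first exact: bigsetU_measurable.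
  by rewrite (le_trans (leeD (PDet k) (PEnt k)))// -EFinD -mulrDl.
exists (lim_sup_set F); split => //.
  by apply: bigcapT_measurable => k; exact: bigcup_measurable.
(* A point that avoids every [F k] with k >= m satisfies the bounds with k0 = m. *)
move=> w /= nb m _; apply: contrapT => wF; apply: nb.
exists m => k mk; have nF : ~ F k w by move=> Fkw; apply: wF; exists k.
split=> [j a b|]; rewrite leNgt; apply/negP => h; apply: nF.
  right; rewrite -bigcup_seq; exists (j, a, b) => //=; exact: mem_index_enum.
by left.
Qed.

End BorelCantelli.

(** * Fejer averages on the circle *)

Section BoundedIntegrable.
Context d (T : measurableType d) (R : realType) (U : probability T R).

Lemma bounded_integrable (g : T -> R) (A : R) :
  measurable_fun setT g -> (forall t, `|g t| <= A) ->
  U.-integrable setT (EFin \o g).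
Proof.
move=> mg gA; apply: measurable_bounded_integrable => //.
  exact: le_lt_trans (probability_le1 U measurableT) (ltry 1).
exists A; split; first exact: num_real.
by move=> x Ax t _; rewrite /= (le_trans (gA t))// ltW.
Qed.

Lemma normr_Rintegral_le (g : T -> R) (A : R) :
  measurable_fun setT g -> (forall t, `|g t| <= A) ->
  `|\int[U]_t g t| <= A.
Proof.
move=> mg gA; have ig := bounded_integrable mg gA.
have cE r : \int[U]_t r = r.
  rewrite (@Rintegral_cst _ _ _ U setT measurableT) -[RHS]mulr1; congr (_ * _).
  exact: (congr1 fine (probability_setT U)).
have ic r : U.-integrable setT (EFin \o (fun=> r)).
  by apply: (@bounded_integrable _ `|r|).
rewrite ler_norml; apply/andP; split.
  by rewrite -[leLHS]cE; apply: le_Rintegral => // t _; have := gA t; rewrite ler_norml => /andP[].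
by rewrite -[leRHS]cE; apply: le_Rintegral => // t _; have := gA t; rewrite ler_norml => /andP[].
Qed.

Lemma Rintegral_sum (I : Type) (r : seq I) (g : I -> T -> R) (A : I -> R) :
  (forall i, measurable_fun setT (g i)) -> (forall i t, `|g i t| <= A i) ->
  \int[U]_t (\sum_(i <- r) g i t) = \sum_(i <- r) \int[U]_t g i t.
Proof.
move=> mg gA; elim: r => [|i r IH].
  rewrite big_nil; under eq_Rintegral do rewrite big_nil.
  by rewrite (@Rintegral_cst _ _ _ U setT measurableT) mul0r.
rewrite big_cons -IH; under eq_Rintegral do rewrite big_cons.
apply: RintegralD => //; first exact: bounded_integrable (gA i).
apply: (@bounded_integrable _ (\sum_(i <- r) A i)).
  exact: measurable_sum.
by move=> t; rewrite (le_trans (ler_norm_sum _ _ _))// ler_sum.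
Qed.

End BoundedIntegrable.

Section CircleIntegrals.
Variable R : realType.
Local Notation U := (uniform_prob (ltr0_2pi R)).
Local Notation mu := (@lebesgue_measure R).

Lemma Rintegral_uniform_derive (F f : R -> R) :
  (forall t : R, is_derive t 1 F (f t)) -> continuous f -> (forall t, `|f t| <= 1) ->
  F 0 = F (2 * pi) -> \int[U]_t f t = 0.
Proof.
move=> dF cf f1 F0.
have mf : measurable_fun setT f by exact: continuous_measurable_fun.
have pi2 := ltr0_2pi R.
(* Adding 1 makes the integrand nonnegative, as [integral_uniform] requires; its primitive is t + F
   t. *)
have E1 : (\int[U]_t (1 + f t)%:E = 1%:E)%E.
  rewrite integral_uniform; last 2 first.
  - by apply/measurable_EFinP; exact: measurable_funD.
  - by move=> t; rewrite lee_fin -lerBlDl sub0r; have := f1 t; rewrite ler_norml => /andP[].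
  pose G t := t + F t.
  have dG (t : R) : is_derive t 1 G (1 + f t).
    by apply: is_deriveD; exact: dF.
  have cG : continuous G.
    by move=> t; apply: differentiable_continuous; apply/derivable1_diffP; exact: ex_derive.
  rewrite (@continuous_FTC2 _ (fun t => 1 + f t) G)//.
  - by rewrite /G add0r F0 -EFinB addrK subr0 -EFinM mulVf// gt_eqF.
  - apply: continuous_subspaceT => t; apply: cvgD; first exact: cvg_cst.
    exact: cf.
  - split; first by move=> t _; exact: ex_derive.
    + by apply: cvg_at_right_filter; exact: cG.
    + by apply: cvg_at_left_filter; exact: cG.
  - by move=> t _; rewrite derive1E; exact: derive_val.
have i1 : U.-integrable setT (EFin \o (fun=> 1)).
  by apply: (@bounded_integrable _ _ _ _ _ 1) => // t; rewrite normr1.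
have : \int[U]_t (1 + f t) = 1 + \int[U]_t f t.
  rewrite RintegralD//; last by apply: (@bounded_integrable _ _ _ _ _ 1).
  rewrite (@Rintegral_cst _ _ _ U setT measurableT) mul1r; congr (_ + _).
  exact: (congr1 fine (probability_setT U)).
rewrite /Rintegral E1 /= => /eqP; rewrite -subr_eq0 opprD addrA subrr add0r oppr_eq0.
by move/eqP.
Qed.

Lemma circle_nat2pi m :
  cos (m%:R * (2 * pi)) = 1 :> R /\ sin (m%:R * (2 * pi)) = 0 :> R.
Proof.
have e2 : 2 * pi = pi *+ 2 :> R by rewrite mulr_natl.
elim: m => [|m [IHc IHs]]; first by rewrite mul0r cos0 sin0.
by rewrite -natr1 mulrDl mul1r [X in cos (_ + X)]e2 [X in sin (_ + X)]e2 cosD2pi sinD2pi.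
Qed.

Lemma Rintegral_uniform_cos m : (0 < m)%N -> \int[U]_t cos (m%:R * t) = 0.
Proof.
move=> m0; have mR : m%:R != 0 :> R by rewrite pnatr_eq0 -lt0n.
apply: (@Rintegral_uniform_derive (fun t => m%:R^-1 * sin (m%:R * t))).
- by move=> t; apply: is_derive_eq; rewrite /GRing.scale /=; field.
- move=> t; apply: continuous_comp; last exact: continuous_cos.
  by apply: cvgM; [exact: cvg_cst|exact: cvg_id].
- by move=> t; rewrite ler_norml cos_geN1 cos_le1.
- by rewrite mulr0 sin0 (circle_nat2pi m).2.
Qed.

Lemma Rintegral_uniform_sin m : (0 < m)%N -> \int[U]_t sin (m%:R * t) = 0.
Proof.
move=> m0; have mR : m%:R != 0 :> R by rewrite pnatr_eq0 -lt0n.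
apply: (@Rintegral_uniform_derive (fun t => - (m%:R^-1 * cos (m%:R * t)))).
- by move=> t; apply: is_derive_eq; rewrite /GRing.scale /=; field.
- move=> t; apply: continuous_comp; last exact: continuous_sin.
  by apply: cvgM; [exact: cvg_cst|exact: cvg_id].
- by move=> t; rewrite ler_norml sin_geN1 sin_le1.
- by rewrite mulr0 cos0 (circle_nat2pi m).1.
Qed.

(* [circle_point] with its codomain seen as a field instead of as [borelC R]. *)
Definition circle_pt (t : R) : R[i] := cos t +i* sin t.

Lemma circle_ptX t m : circle_pt t ^+ m = cos (m%:R * t) +i* sin (m%:R * t).
Proof.
elim: m => [|m IH]; first by rewrite expr0 mul0r cos0 sin0.
rewrite exprS IH -[in RHS]natr1 mulrDl mul1r cosD sinD /circle_pt.
apply/eqP; rewrite eq_complex /= [_ * cos t]mulrC [_ * sin t]mulrC eqxx /=.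
by apply/eqP; ring.
Qed.

Lemma normc_circle_pt t : normc (circle_pt t) = 1.
Proof. by rewrite /= cos2Dsin2 sqrtr1. Qed.

End CircleIntegrals.

Section FejerKernel.
Variable R : realType.
Local Notation U := (uniform_prob (ltr0_2pi R)).
Implicit Types (w x z : R[i]) (t : R).

(** The distance |j - l|: one of the two truncated differences is zero. *)
Definition index_dist (j l : nat) := (j - l + (l - j))%N.

Lemma Re_conj z : complex.Re (z^*)%R = complex.Re z. Proof. by case: z. Qed.

Lemma mulr_conj_unit x : normc x = 1 -> x * (x^*)%R = 1.
Proof. by move=> x1; rewrite mulrC conjC_normc x1 expr1n. Qed.

(** On the unit circle x^* is the inverse of x, and the real part ignores the sign of the exponent;
    thus power sums of nonnegative order suffice. *)
Lemma Re_expr_mul_conj x j l : normc x = 1 ->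
  complex.Re (x ^+ j * (x^*)%R ^+ l) = complex.Re (x ^+ index_dist j l).
Proof.
move=> x1; rewrite /index_dist; have [lj|/ltnW jl] := leqP l j.
  rewrite -{1}(subnK lj) exprD -mulrA -exprMn mulr_conj_unit// expr1n mulr1.
  by move: lj; rewrite -subn_eq0 => /eqP ->; rewrite addn0.
rewrite -{1}(subnK jl) exprD mulrCA -exprMn mulr_conj_unit// expr1n mulr1.
by move: jl; rewrite -subn_eq0 => /eqP ->; rewrite add0n -Re_conj rmorphXn /= conjCK.
Qed.

Lemma sqr_normc_geometric x M : normc x = 1 ->
  normc (\sum_(j < M) x ^+ j) ^+ 2 =
  \sum_(j < M) \sum_(l < M) complex.Re (x ^+ index_dist j l).
Proof.
move=> x1; rewrite -[LHS]/(complex.Re ((normc (\sum_(j < M) x ^+ j) ^+ 2)%:C)).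
rewrite -conjC_normc mulrC rmorph_sum /= mulr_suml Re_sum.
apply: eq_bigr => j _; rewrite mulr_sumr Re_sum; apply: eq_bigr => l _.
by rewrite rmorphXn Re_expr_mul_conj.
Qed.

Lemma sqr_normc_geometric_le x M : normc x = 1 ->
  normc (\sum_(j < M) x ^+ j) ^+ 2 * normc (1 - x) ^+ 2 <= 4.
Proof.
move=> x1; rewrite -exprMn -normcM mulrC.
have -> : (1 - x) * (\sum_(j < M) x ^+ j) = 1 - x ^+ M.
  by rewrite -[1 - x]opprB mulNr -subrX1 opprB.
have -> : 4 = 2 ^+ 2 :> R by rewrite -natrX.
apply: lerXn2r; rewrite ?nnegrE ?normc_ge0//.
by rewrite (le_trans (le_normcD _ _))// normcN normcX x1 expr1n normc1.
Qed.

(** For w = exp(i theta) this is cos(m (theta - t)). *)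
Definition trig_mono w m t := complex.Re ((w * (circle_pt t)^*%R) ^+ m).

Lemma trig_monoE w m t : trig_mono w m t =
  complex.Re (w ^+ m) * cos (m%:R * t) + complex.Im (w ^+ m) * sin (m%:R * t).
Proof.
rewrite /trig_mono exprMn -rmorphXn /= circle_ptX; case: (w ^+ m) => a b /=.
by rewrite mulrN opprK.
Qed.

Lemma normc_unit_conj w t : normc w = 1 -> normc (w * (circle_pt t)^*%R) = 1.
Proof.
move=> w1; rewrite normcM w1 mul1r; apply: complexI.
by rewrite -normr_normc norm_conjC normr_normc normc_circle_pt.
Qed.

Lemma continuous_trig_mono w m : continuous (trig_mono w m).
Proof.
rewrite (_ : trig_mono w m = fun t => complex.Re (w ^+ m) * cos (m%:R * t) +
    complex.Im (w ^+ m) * sin (m%:R * t)); last by apply/funext => t; rewrite trig_monoE.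
move=> t; apply: cvgD; apply: cvgM; try exact: cvg_cst.
- by apply: continuous_comp; [apply: cvgM; [exact: cvg_cst|exact: cvg_id]|exact: continuous_cos].
- by apply: continuous_comp; [apply: cvgM; [exact: cvg_cst|exact: cvg_id]|exact: continuous_sin].
Qed.

Lemma measurable_trig_mono w m : measurable_fun setT (trig_mono w m).
Proof. exact: continuous_measurable_fun (@continuous_trig_mono w m). Qed.

Lemma normr_trig_mono_le1 w m t : normc w = 1 -> `|trig_mono w m t| <= 1.
Proof.
move=> w1; rewrite (le_trans (ler_Re_normc _))// normcX normc_unit_conj//.

Qed.

Lemma Rintegral_trig_mono w m : normc w = 1 ->
  \int[U]_t trig_mono w m t = (m == 0)%:R.
Proof.
move=> w1; have [->|m0] := eqVneq m 0%N.
  under eq_Rintegral do rewrite /trig_mono expr0.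
  rewrite (@Rintegral_cst _ _ _ U setT measurableT) mul1r.
  exact: (congr1 fine (probability_setT U)).
under eq_Rintegral do rewrite trig_monoE.
have ccos : measurable_fun setT (fun t : R => cos (m%:R * t)).
  apply: continuous_measurable_fun => t; apply: continuous_comp; last exact: continuous_cos.
  by apply: cvgM; [exact: cvg_cst|exact: cvg_id].
have csin : measurable_fun setT (fun t : R => sin (m%:R * t)).
  apply: continuous_measurable_fun => t; apply: continuous_comp; last exact: continuous_sin.
  by apply: cvgM; [exact: cvg_cst|exact: cvg_id].
have icos : U.-integrable setT (EFin \o (fun t : R => cos (m%:R * t))).
  by apply: (@bounded_integrable _ _ _ _ _ 1) => // t; rewrite ler_norml cos_geN1 cos_le1.
have isin : U.-integrable setT (EFin \o (fun t : R => sin (m%:R * t))).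
  by apply: (@bounded_integrable _ _ _ _ _ 1) => // t; rewrite ler_norml sin_geN1 sin_le1.
have bnd (c a : R) : `|a| <= 1 -> `|c * a| <= `|c|.
  by move=> a1; rewrite normrM ler_piMr.
rewrite RintegralD//.
- rewrite (@RintegralZl _ _ _ U)// (@RintegralZl _ _ _ U)//.
  by rewrite Rintegral_uniform_cos ?lt0n// Rintegral_uniform_sin ?lt0n// !mulr0 addr0.
- apply: (@bounded_integrable _ _ _ _ _ `|complex.Re (w ^+ m)|).
    exact: measurable_funM.
  by move=> t; apply: bnd; rewrite ler_norml cos_geN1 cos_le1.
- apply: (@bounded_integrable _ _ _ _ _ `|complex.Im (w ^+ m)|).
    exact: measurable_funM.
  by move=> t; apply: bnd; rewrite ler_norml sin_geN1 sin_le1.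
Qed.

(** For w = exp(i theta), the Fejer kernel at theta - t. As the square of a geometric sum it is
    visibly nonnegative; expanded, it is a combination of the [trig_mono]. *)
Definition fejer M w t :=
  M%:R^-1 * normc (\sum_(j < M) (w * (circle_pt t)^*%R) ^+ j) ^+ 2.

Lemma fejer_ge0 M w t : 0 <= fejer M w t.
Proof. by rewrite mulr_ge0// ?invr_ge0// exprn_ge0// normc_ge0. Qed.

Lemma fejerE M w t : normc w = 1 -> fejer M w t =
  M%:R^-1 * \sum_(j < M) \sum_(l < M) trig_mono w (index_dist j l) t.
Proof. by move=> w1; rewrite /fejer sqr_normc_geometric// normc_unit_conj. Qed.

Lemma fejer_le M w t (e : R) : normc w = 1 -> 0 < e ->
  e <= normc (w - circle_pt t) -> fejer M w t <= 4 / (M%:R * e ^+ 2).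
Proof.
move=> w1 e0; have -> : normc (w - circle_pt t) = normc (1 - w * (circle_pt t)^*%R).
  rewrite -[RHS]mulr1 -(normc_circle_pt t) -normcM mulrBl mul1r -mulrA.
  by rewrite conjC_normc normc_circle_pt expr1n mulr1 -normcN opprB.
move=> ed; have := sqr_normc_geometric_le M (normc_unit_conj t w1).
rewrite /fejer; set S := normc _ ^+ 2; set q := normc _ => Sq.
have S0 : 0 <= S by rewrite exprn_ge0// normc_ge0.
rewrite invfM [leRHS]mulrCA ler_wpM2l ?invr_ge0//.
rewrite ler_pdivlMr ?exprn_gt0// (le_trans _ Sq)// ler_wpM2l//.
by apply: lerXn2r; rewrite ?nnegrE ?(ltW e0)// (le_trans (ltW e0)).
Qed.

Lemma measurable_fejer M w : normc w = 1 -> measurable_fun setT (fejer M w).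
Proof.
move=> w1; rewrite (_ : fejer M w = fun t => M%:R^-1 *
    \sum_(j < M) \sum_(l < M) trig_mono w (index_dist j l) t).
  apply: measurable_funM => //; apply: measurable_sum => j.
  by apply: measurable_sum => l; exact: measurable_trig_mono.
by apply/funext => t; rewrite fejerE.
Qed.

Lemma fejer_le_size M w t : normc w = 1 -> `|fejer M w t| <= M%:R.
Proof.
move=> w1; have [->|M0] := eqVneq M 0%N.
  by rewrite /fejer invr0 mul0r normr0.
rewrite fejerE// normrM ger0_norm ?invr_ge0//.
rewrite ler_pdivrMl ?ltr0n ?lt0n//.
rewrite (le_trans (ler_norm_sum _ _ _))//.
apply: (@le_trans _ _ (\sum_(j < M) M%:R)); last first.
  by rewrite sumr_const card_ord mulr_natl.
apply: ler_sum => j _; rewrite (le_trans (ler_norm_sum _ _ _))//.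
apply: (@le_trans _ _ (\sum_(l < M) 1)); last first.
  by rewrite sumr_const card_ord.
by apply: ler_sum => l _; exact: normr_trig_mono_le1.
Qed.

Lemma index_dist_eq0 j l : (index_dist j l == 0%N) = (j == l).
Proof. by rewrite addn_eq0 !subn_eq0 -eqn_leq. Qed.

Lemma sum_eq_ord M (c : R) : \sum_(j < M) \sum_(l < M) (j == l)%:R * c = M%:R * c.
Proof.
under eq_bigr => j _.
  rewrite -mulr_suml (bigD1 j)//= eqxx big1 ?addr0 ?mul1r; first over.
  by move=> l; rewrite eq_sym => /negbTE ->.
by rewrite sumr_const card_ord mulr_natl.
Qed.

Lemma Rintegral_fejer M w : (0 < M)%N -> normc w = 1 ->
  \int[U]_t fejer M w t = 1.
Proof.
move=> M0 w1; under eq_Rintegral do rewrite fejerE//.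
have mt m := measurable_trig_mono w m.
have b1 m t := @normr_trig_mono_le1 w m t w1.
have msum (j : 'I_M) : measurable_fun setT
    (fun t => \sum_(l < M) trig_mono w (index_dist j l) t).
  by apply: measurable_sum => l.
have bsum (j : 'I_M) t : `|\sum_(l < M) trig_mono w (index_dist j l) t| <= \sum_(l < M) 1.
  by rewrite (le_trans (ler_norm_sum _ _ _))// ler_sum.
rewrite (@RintegralZl _ _ _ U)//; last first.
  apply: (@bounded_integrable _ _ _ _ _ (\sum_(j < M) \sum_(l < M) 1)).
    exact: measurable_sum.
  by move=> t; rewrite (le_trans (ler_norm_sum _ _ _))// ler_sum.
have -> : \int[U]_t (\sum_(j < M) \sum_(l < M) trig_mono w (index_dist j l) t) =
    \sum_(j < M) \int[U]_t (\sum_(l < M) trig_mono w (index_dist j l) t).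
  exact: (Rintegral_sum U _ msum bsum).
under eq_bigr => j _.
  have -> : \int[U]_t (\sum_(l < M) trig_mono w (index_dist j l) t) =
      \sum_(l < M) \int[U]_t trig_mono w (index_dist j l) t.
    apply: (@Rintegral_sum _ _ _ U _ _
      (fun l : 'I_M => trig_mono w (index_dist j l)) (fun=> 1)) => [l|l t].
      exact: mt.
    exact: b1.
  under eq_bigr => l _ do rewrite Rintegral_trig_mono// index_dist_eq0 -[_%:R]mulr1.
  over.
by rewrite (sum_eq_ord M 1) mulr1 mulVf// pnatr_eq0 -lt0n.
Qed.

(** In the double sum over j and l, the M diagonal terms give N each and every other term is
    controlled by a power sum of order |j - l|, between 1 and M - 1. At most M^2 errors h are
    divided by M. *)
Lemma sum_fejer_near M (ws : seq R[i]) (h : R) t (N := size ws) : (0 < M)%N ->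
  {in ws, forall w, normc w = 1} ->
  (forall m, (0 < m < M)%N -> normc (\sum_(w <- ws) w ^+ m) <= h) -> 0 <= h ->
  `|\sum_(w <- ws) fejer M w t - N%:R| <= M%:R * h.
Proof.
move=> M0 w1 wh h0; have MR : M%:R != 0 :> R by rewrite pnatr_eq0 -lt0n.
have -> : \sum_(w <- ws) fejer M w t - N%:R = M%:R^-1 * \sum_(j < M) \sum_(l < M)
    (\sum_(w <- ws) trig_mono w (index_dist j l) t - (j == l)%:R * N%:R).
  under [in RHS]eq_bigr do rewrite sumrB.
  rewrite sumrB sum_eq_ord mulrBr mulKf//; congr (_ - _).
  rewrite big_seq; under eq_bigr => w /w1 ww1 do rewrite fejerE//.
  rewrite -big_seq -mulr_sumr; congr (_ * _).
  rewrite exchange_big; apply: eq_bigr => j _; exact: exchange_big.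
rewrite normrM ger0_norm ?invr_ge0// ler_pdivrMl ?ltr0n//.
rewrite (le_trans (ler_norm_sum _ _ _))//.
apply: (@le_trans _ _ (\sum_(j < M) M%:R * h)); last first.
  by rewrite sumr_const card_ord -[_ *+ _]mulr_natl.
apply: ler_sum => j _; rewrite (le_trans (ler_norm_sum _ _ _))//.
apply: (@le_trans _ _ (\sum_(l < M) h)); last first.
  by rewrite sumr_const card_ord mulr_natl.
apply: ler_sum => l _; have [jl|jl] := eqVneq j l.
  rewrite jl /index_dist subnn mul1r.
  under eq_bigr do rewrite /trig_mono expr0.
  by rewrite big_const_seq count_predT iter_addr_0 subrr normr0.
rewrite mul0r subr0 /trig_mono -Re_sum (le_trans (ler_Re_normc _))//.
under eq_bigr do rewrite exprMn.
rewrite -mulr_suml -rmorphXn normcM.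
have -> : normc ((circle_pt t ^+ index_dist j l)^*)%R = 1.
  apply: complexI; rewrite -normr_normc norm_conjC normr_normc normcX normc_circle_pt.
  by rewrite expr1n.
rewrite mulr1 wh// lt0n index_dist_eq0 jl /=.
rewrite /index_dist; have [lj|/ltnW] := leqP l j.
  move: (lj); rewrite -subn_eq0 => /eqP ->; rewrite addn0.
  by rewrite (leq_ltn_trans (leq_subr _ _)).
by rewrite -subn_eq0 => /eqP ->; rewrite add0n (leq_ltn_trans (leq_subr _ _)).
Qed.

(** The kernel has integral 1, so the left side is an integral over t whose integrand is bounded
    pointwise. The three terms come from the w within r of the point at t, from the other w, where
    the kernel decays, and from the defect of the kernels from summing to N. *)
Lemma fejer_estimate (f : R[i]^o -> R) (ws : seq R[i]) (M : nat) (A e r h : R)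
    (N := (size ws)%:R : R) :
  continuous f -> (forall z, `|f z| <= A) ->
  (forall z z', normc (z - z') < r -> `|f z - f z'| <= e) -> 0 < r ->
  (0 < M)%N -> {in ws, forall w, normc w = 1} ->
  (forall m, (0 < m < M)%N -> normc (\sum_(w <- ws) w ^+ m) <= h) -> 0 <= h ->
  `|\sum_(w <- ws) f w - N * \int[U]_t f (circle_pt t)| <=
    e * (N + M%:R * h) + N * (A * 8 / (M%:R * r ^+ 2)) + A * (M%:R * h).
Proof.
move=> cf fA fe r0 M0 w1 wh h0.
have A0 : 0 <= A by exact: le_trans (normr_ge0 _) (fA 0).
have e0 : 0 <= e.
  by have := fe 0 0; rewrite !subrr normc0 normr0; apply.
have mfe : measurable_fun setT (fun t : R => f (circle_pt t)).
  exact: (measurableT_comp (continuous_measurable_funC cf) (@measurable_circle_point R)).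
have ife : U.-integrable setT (EFin \o (fun t => f (circle_pt t))).
  exact: (@bounded_integrable _ _ _ _ _ A).
(* Extended by 0 off the circle, since [Rintegral_sum] asks for measurability and a bound at every
   index w. *)
pose g (w : R[i]) t := if normc w == 1 then f w * fejer M w t else 0.
have mg w : measurable_fun setT (g w).
  rewrite /g; case: eqP => [ww1|_]; last exact: measurable_cst.
  by apply: measurable_funM => //; exact: measurable_fejer.
have bg w t : `|g w t| <= A * M%:R.
  rewrite /g; case: eqP => [ww1|_]; last by rewrite normr0 mulr_ge0.
  by rewrite normrM ler_pM// fejer_le_size.
have Ig w : normc w = 1 -> \int[U]_t g w t = f w.
  move=> ww1; rewrite /g ww1 eqxx (@RintegralZl _ _ _ U)//.
    by rewrite Rintegral_fejer// mulr1.
  apply: (@bounded_integrable _ _ _ _ _ M%:R); first exact: measurable_fejer.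
  by move=> t; exact: fejer_le_size.
have msg : measurable_fun setT (fun t => \sum_(w <- ws) g w t).
  exact: measurable_sum.
have bsg t : `|\sum_(w <- ws) g w t| <= \sum_(w <- ws) A * M%:R.
  by rewrite (le_trans (ler_norm_sum _ _ _))// ler_sum.
have mN : measurable_fun setT (fun t => N * f (circle_pt t)).
  exact: measurable_funM.
have bN t : `|N * f (circle_pt t)| <= N * A.
  by rewrite normrM ger0_norm ?ler_wpM2l.
have -> : \sum_(w <- ws) f w - N * \int[U]_t f (circle_pt t) =
    \int[U]_t (\sum_(w <- ws) g w t - N * f (circle_pt t)).
  rewrite RintegralB//; last 2 first.
  - exact: (@bounded_integrable _ _ _ _ _ (\sum_(w <- ws) A * M%:R)).
  - exact: (@bounded_integrable _ _ _ _ _ (N * A)).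
  rewrite (@RintegralZl _ _ _ U)// (Rintegral_sum U ws mg bg); congr (_ - _).
  by rewrite big_seq [RHS]big_seq; apply: eq_bigr => w /w1 /Ig ->.
apply: normr_Rintegral_le; first exact: measurable_funB.
move=> t; have near := sum_fejer_near t M0 w1 wh h0.
have -> : \sum_(w <- ws) g w t - N * f (circle_pt t) =
    \sum_(w <- ws) (f w - f (circle_pt t)) * fejer M w t +
    f (circle_pt t) * (\sum_(w <- ws) fejer M w t - N).
  under [in RHS]eq_bigr do rewrite mulrBl.
  rewrite sumrB -mulr_sumr mulrBr addrA subrK [_ * N]mulrC; congr (_ - _).
  rewrite big_seq [RHS]big_seq; apply: eq_bigr => w /w1 ww1.
  by rewrite /g ww1 eqxx.
rewrite (le_trans (ler_normD _ _))// lerD//; last first.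
  by rewrite normrM ler_pM.
apply: (@le_trans _ _ (\sum_(w <- ws) (e * fejer M w t + A * 8 / (M%:R * r ^+ 2)))).
  rewrite (le_trans (ler_norm_sum _ _ _))// big_seq [leRHS]big_seq.
  apply: ler_sum => w /w1 ww1; rewrite normrM [X in _ * X]ger0_norm ?fejer_ge0//.
  have c0 : 0 <= A * 8 / (M%:R * r ^+ 2).
    by rewrite divr_ge0// mulr_ge0// exprn_ge0// ltW.
  have [wr|rw] := ltP (normc (w - circle_pt t)) r.
    rewrite -[leLHS]addr0 lerD// ler_wpM2r ?fejer_ge0//; exact: fe.
  rewrite -[leLHS]add0r lerD//; first by rewrite mulr_ge0// fejer_ge0.
  have fA2 : `|f w - f (circle_pt t)| <= A * 2.
    by rewrite (le_trans (ler_normB _ _))// mulr_natr mulr2n lerD.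
  have := fejer_le M ww1 r0 rw; set c := 4 / _ => Fc.
  have -> : A * 8 / (M%:R * r ^+ 2) = A * 2 * c.
    by rewrite /c !mulrA -[A * 2 * 4]mulrA -natrM.
  by rewrite ler_pM ?fejer_ge0.
rewrite big_split /= -mulr_sumr big_const_seq count_predT iter_addr_0 -[_ *+ size ws]mulr_natl.
rewrite lerD2r ler_wpM2l// -lerBlDl (le_trans _ near)//.
exact: ler_norm.
Qed.

End FejerKernel.

(** * Roots of the characteristic determinant *)

(** The coefficients of degree k of the entries form the identity matrix, so taking top coefficients
    in the Leibniz formula gives its determinant. *)
Lemma lead_coef_det_monic_mxpoly (F : comNzRingType) (n k : nat)
    (C : 'I_k -> 'M[F]_n) : lead_coef (\det (monic_mxpoly C)) = 1.
Proof.
rewrite lead_coefE size_det_monic_mxpoly /= -[RHS](det1 F n) /determinant coef_sum.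
have szS a b : (size (\sum_(j < k) C j a b *: 'X^j : {poly F})%R <= k)%N.
  apply: (leq_trans (size_sum _ _ _)); apply/bigmax_leqP => j _.
  by rewrite (leq_trans (size_scale_leq _ _))// size_polyXn ltn_ord.
have szM a b : (size (monic_mxpoly C a b) <= k.+1)%N.
  rewrite monic_mxpolyE (leq_trans (size_polyD _ _))// geq_max.
  rewrite (leq_trans (szS a b))// andbT -[_ *+ _]scaler_nat.
  by rewrite (leq_trans (size_scale_leq _ _))// size_polyXn.
have szI : size (index_enum 'I_n) = n by rewrite -[RHS]card_ord cardT enumT.
apply: eq_bigr => s _; rewrite -(rmorph_sign (@polyC F)) coefCM; congr (_ * _).
have [_ ] := coef_prod_top (index_enum 'I_n) (fun i => szM i (s i)).
rewrite szI => ->; apply: eq_bigr => i _.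
by rewrite monic_mxpolyE coefD coefMn coefXn eqxx nth_default ?szS// addr0 mxE.
Qed.

Lemma coef0_det_monic_mxpoly (F : comNzRingType) (n k : nat)
    (C : 'I_k.+1 -> 'M[F]_n) : (\det (monic_mxpoly C))`_0 = \det (C ord0).
Proof.
rewrite -horner_coef0 -[LHS]/(horner_eval 0 (\det (monic_mxpoly C))) -det_map_mx.
congr (\det _); apply/matrixP => a b.
rewrite mxE -[LHS]/((monic_mxpoly C a b).[0]) monic_mxpolyE horner_coef0 coefD coefMn coefXn mul0rn add0r.
rewrite coef_sum big_ord_recl coefZ coefXn /= mulr1 big1 ?addr0// => j _.
by rewrite coefZ coefXn mulr0.
Qed.

Lemma det_monic_mxpoly_eigenvalues (F : closedFieldType) (n k : nat)
    (C : 'I_k -> 'M[F]_n) :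
  \det (monic_mxpoly C) = \prod_(z <- eigenvalues (monic_mxpoly C)) ('X - z%:P).
Proof.
rewrite /eigenvalues; case: closed_field_poly_normal => s /= {1}->.
by rewrite lead_coef_det_monic_mxpoly scale1r.
Qed.

Lemma ln_polynomial_le_linear (R : realType) (c e : R) (D : nat) :
  0 < c -> 0 < e ->
  exists k0, forall k, (k0 <= k)%N -> ln (c * k.+1%:R ^+ D) <= e * k.+1%:R.
Proof.
(* From exp(e K) >= (e K)^(D+1) / (D+1)! with K = k + 1: this dominates c K^D once K >= c (D+1)! /
   e^(D+1). *)
move=> c0 e0; exists (Num.trunc (c * D.+1`!%:R / e ^+ D.+1)) => k hk.
have K0 : 0 < k.+1%:R :> R by [].
have big : c * D.+1`!%:R / e ^+ D.+1 <= k.+1%:R.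
  rewrite ltW// (lt_le_trans (truncnS_gt _))// ler_nat ltnS//.
have f0 : 0 < D.+1`!%:R :> R by rewrite ltr0n fact_gt0.
rewrite -[leRHS]expRK ler_ln ?posrE ?expR_gt0 ?mulr_gt0 ?exprn_gt0//.
rewrite (le_trans _ (expR_ge1Dxn D _)) ?mulr_ge0 ?(ltW e0)//.
rewrite (le_trans _ (ler_wpDl _ (lexx _)))//.
rewrite ler_pdivrMr ?exprn_gt0// in big.
rewrite exprMn ler_pdivlMr//.
apply: (@le_trans _ _ (k.+1%:R * e ^+ D.+1 * k.+1%:R ^+ D)).
  by rewrite mulrAC ler_wpM2r// exprn_ge0.
by rewrite [k.+1%:R ^+ D.+1]exprS mulrCA mulrA.
Qed.

(** * Continuous test functions with compact support *)

Section CompactSupport.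
Variables (R : realType) (f : R[i]^o -> R).
Hypothesis cf : continuous f.
Hypothesis f_supp : compact (closure [set z | f z != 0]).

Lemma continuousC_dist (x : R[i]) (e : R) : 0 < e ->
  exists2 r : R, 0 < r & forall y, normc (x - y) < r -> `|f x - f y| < e.
Proof.
move=> e0; have := @cf x => /(@cvgrPdist_lt _ _ _ _ (nbhs_filter (x : R[i]^o))) /(_ _ e0).
move=> /(@nbhs_ballP _ R[i]^o) [r /= r0 rf]; exists (complex.Re r).
  by move: r0; rewrite ltcE => /andP[].
move=> y xy; apply: rf; rewrite /ball /= -[X in _ < X]RRe_real ?gtr0_real//.
by rewrite normr_normc ltcR.
Qed.

Lemma nbhs_normc (x : R[i]) (r : R) : 0 < r ->
  nbhs (x : R[i]^o) [set y | normc (x - y) < r].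
Proof.
move=> r0; apply/(@nbhs_ballP _ R[i]^o); exists r%:C; first by rewrite /= ltcR.
by move=> y; rewrite /ball /= normr_normc ltcR.
Qed.

Lemma near_inv_nat_lt (r : R) : 0 < r -> \forall m \near \oo, m.+1%:R^-1 < r.
Proof.
move=> r0; exists (Num.trunc r^-1) => // m /= hm.
rewrite invf_plt ?posrE// (lt_le_trans (truncnS_gt _))// ler_nat ltnS//.
Qed.

(** Compactness gives a uniform radius for points of the support against arbitrary points; two
    points at which f vanishes need nothing. *)
Lemma compact_support_unif_continuous (e : R) : 0 < e ->
  exists2 r : R, 0 < r & forall x y, normc (x - y) < r -> `|f x - f y| <= e.
Proof.
move=> e0; pose K := closure [set z : R[i]^o | f z != 0].
pose Q (m : nat) (x : R[i]^o) := forall y, normc (x - y) < m.+1%:R^-1 -> `|f x - f y| <= e.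
have : \forall m \near \oo, K `<=` Q m.
  have /compact_near_coveringP := f_supp; apply => x _.
  have e20 : 0 < e / 2 by rewrite divr_gt0.
  have [r r0 rf] := continuousC_dist x e20.
  have r20 : 0 < r / 2 by rewrite divr_gt0.
  exists ([set y | normc (x - y) < r / 2], [set m : nat | m.+1%:R^-1 < r / 2]).
    by split; [exact: nbhs_normc|exact: near_inv_nat_lt].
  move=> -[y m] [/= xy mr] z yz.
  have h1 : `|f x - f y| < e / 2 by apply: rf; rewrite (lt_trans xy)// ltr_pdivrMr// ltr_pMr// ltr1n.
  have h2 : `|f x - f z| < e / 2.
    apply: rf; rewrite -[x - z](subrKA y) (le_lt_trans (le_normcD _ _))//.
    by rewrite [ltRHS]splitr ltrD// (lt_trans yz).
  rewrite -[f y - f z](subrKA (f x)) (le_trans (ler_normD _ _))// distrC.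
  by rewrite [leRHS]splitr lerD// ltW.
move=> [m _ /(_ m (leqnn m)) /= KQ]; exists m.+1%:R^-1; first by rewrite invr_gt0.
move=> x y xy; have [fx|fx] := eqVneq (f x) 0; last first.
  by apply: KQ => //; exact: subset_closure.
have [fy|fy] := eqVneq (f y) 0; first by rewrite fx fy subrr normr0 ltW.
rewrite distrC; apply: KQ; first exact: subset_closure.
by rewrite -normcN opprB.
Qed.

Lemma compact_support_bounded : exists A : R, forall x, `|f x| <= A.
Proof.
pose K := closure [set z : R[i]^o | f z != 0].
pose Q (m : nat) (x : R[i]^o) := `|f x| <= m%:R.
have : \forall m \near \oo, K `<=` Q m.
  have /compact_near_coveringP := f_supp; apply => x _.
  have [r r0 rf] := continuousC_dist x ltr01.
  exists ([set y | normc (x - y) < r], [set m : nat | `|f x| + 1 <= m%:R]).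
    split; first exact: nbhs_normc.
    exists (Num.trunc (`|f x| + 1)).+1 => // m /= hm.
    by rewrite ltW// (lt_le_trans (truncnS_gt _))// ler_nat.
  move=> -[y m] [/= /rf xy]; apply: le_trans.
  rewrite -[f y](subrK (f x)) addrC (le_trans (ler_normD _ _))// lerD2l distrC.
  exact: ltW.
move=> [m _ /(_ m (leqnn m)) /= KQ]; exists m%:R => x.
have [->|fx] := eqVneq (f x) 0; first by rewrite normr0.
by apply: KQ; exact: subset_closure.
Qed.

End CompactSupport.

Section Integrals.
Variables (R : realType) (f : R[i]^o -> R).
Hypothesis cf : continuous f.

Lemma integral_esd n k (M : 'M[{poly R[i]}]_n) :
  (\int[esd k M]_z (f z)%:E =
   ((k * n)%:R^-1 * \sum_(i < k * n) f (eigenvalues M)`_i)%:E)%E.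
Proof.
have mf := continuous_measurable_funC cf.
have ge0E (g : borelC R -> \bar R) : measurable_fun setT g -> (forall z, 0 <= g z)%E ->
    (\int[esd k M]_z g z = ((k * n)%:R^-1)%:E *
       \sum_(i < k * n) g ((eigenvalues M)`_i : borelC R))%E.
  move=> mg g0; rewrite /esd ge0_integral_mscale//; congr (_ * _)%E.
  rewrite ge0_integral_measure_sum//; apply: eq_bigr => i _.
  by rewrite integral_dirac// diracT mul1e.
(* The formula for nonnegative functions is applied to the positive and negative parts of f. *)
rewrite -[LHS]/(\int[esd k M]_z ((EFin \o (f : borelC R -> R)) z))%E.
rewrite integralE funerpos funerneg !ge0E; last 4 first.
- by apply/measurable_EFinP; exact: measurable_funrneg.
- by move=> z; rewrite lee_fin funrneg_ge0.
- by apply/measurable_EFinP; exact: measurable_funrpos.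
- by move=> z; rewrite lee_fin funrpos_ge0.
rewrite !sumEFin -!EFinM -EFinB; congr (_%:E); rewrite -mulrBr -sumrB.
congr (_ * _); apply: eq_bigr => i _.
by rewrite -[in RHS](funrposBneg (f : borelC R -> R)).
Qed.

Lemma integral_unif_circle (A : R) : (forall z, `|f z| <= A) ->
  (\int[unif_circle R]_z (f z)%:E =
   (\int[uniform_prob (ltr0_2pi R)]_t f (circle_pt t))%:E)%E.
Proof.
move=> fA; have mf := continuous_measurable_funC cf.
have ife : (uniform_prob (ltr0_2pi R)).-integrable setT
    (EFin \o (fun t => f (circle_pt t))).
  apply: (@bounded_integrable _ _ _ _ _ A) => //.
  exact: (measurableT_comp mf (@measurable_circle_point R)).
rewrite integral_distribution//; last exact/measurable_EFinP.
by rewrite /Rintegral fineK//; exact: integrable_fin_num.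
Qed.

End Integrals.

(** * From root bounds to averages of a test function *)

Section Equidistribution.
Variable R : realType.
Implicit Types (z : R[i]) (zs : seq R[i]).

(** The distance from z to the circle is 1 - |a| inside and (1 - |a|) / |a| outside; the factor |a|
    covers both cases, including very large roots. *)
Lemma normc_sub_direction z : z != 0 ->
  normc (z - direction z) * normc (disc_reflect z) <= 1 - normc (disc_reflect z).
Proof.
move=> z0; have nz : 0 < normc z by rewrite normc_gt0.
have nzC : (normc z)%:C != 0 by rewrite (inj_eq (@complexI R)) gt_eqF.
have -> : z - direction z = (normc z - 1)%:C * direction z.
  rewrite /direction rmorphB /= mulrBl mul1r; congr (_ - _).
  by rewrite mulrC divfK.
rewrite normcM normc_direction// mulr1 normcR /disc_reflect normr_normc.
have -> : (1 <= (normc z)%:C) = (1 <= normc z) by rewrite -lecR.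
case: ifP => z1.
  by rewrite normcV ger0_norm ?subr_ge0// mulrBl divff ?gt_eqF// mul1r.
have -> : normc (z^*)%R = normc z.
  by apply: complexI; rewrite -!normr_normc norm_conjC.
have {}z1 : normc z <= 1 by rewrite ltW// ltNge z1.
by rewrite distrC ger0_norm ?subr_ge0// ler_piMr// subr_ge0.
Qed.

(** A Markov-type bound: a root at distance at least r from its direction has r |a| <= 1 - |a|, so
    (1 + r) / r * (1 - |a|) >= 1 and the trivial bound 2 A is absorbed. *)
Lemma normr_sub_direction_le (f : R[i] -> R) (A e r : R) z : z != 0 ->
  (forall x, `|f x| <= A) ->
  (forall x y, normc (x - y) < r -> `|f x - f y| <= e) -> 0 < r ->
  `|f z - f (direction z)| <=
    e + 2 * A * (1 + r) / r * (1 - normc (disc_reflect z)).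
Proof.
move=> z0 fA fe r0; set a := normc (disc_reflect z).
have A0 : 0 <= A by exact: le_trans (normr_ge0 _) (fA 0).
have e0 : 0 <= e by have := fe 0 0; rewrite !subrr normc0 normr0; apply.
have a1 : 0 <= 1 - a by rewrite subr_ge0 normc_disc_reflect_le1.
have c0 : 0 <= 2 * A * (1 + r) / r.
  by rewrite divr_ge0 ?(ltW r0)// !mulr_ge0// addr_ge0// ltW.
have [zr|rz] := ltP (normc (z - direction z)) r.
  by rewrite (le_trans (fe _ _ zr))// lerDl mulr_ge0.
have az := normc_sub_direction z0; rewrite -/a in az.
have a0 : 0 <= a by exact: normc_ge0.
have ra : 1 <= (1 + r) / r * (1 - a).
  rewrite mulrAC ler_pdivlMr// mul1r; nra.
rewrite -[leLHS]add0r lerD// (le_trans (ler_normB _ _))//.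
rewrite (le_trans (lerD (fA _) (fA _)))//.
have -> : 2 * A * (1 + r) / r * (1 - a) = (A + A) * ((1 + r) / r * (1 - a)).
  by field; rewrite gt_eqF.
by rewrite ler_peMr// addr_ge0.
Qed.

Lemma average_roots_estimate (f : R[i]^o -> R) (zs : seq R[i]) (M : nat)
    (A e r h g : R) (N := (size zs)%:R : R) :
  continuous f -> (forall z, `|f z| <= A) ->
  (forall z z', normc (z - z') < r -> `|f z - f z'| <= e) -> 0 < r ->
  (0 < M)%N -> {in zs, forall z, z != 0} -> (0 < size zs)%N ->
  (forall m, (0 < m < M)%N ->
     normc (\sum_(z <- zs) direction z ^+ m) <= h * N) -> 0 <= h ->
  \sum_(z <- zs) (1 - normc (disc_reflect z)) <= g * N ->
  `|N^-1 * \sum_(z <- zs) f z -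
      \int[uniform_prob (ltr0_2pi R)]_t f (circle_pt t)| <=
    e + 2 * A * (1 + r) / r * g +
    (e * (1 + M%:R * h) + A * 8 / (M%:R * r ^+ 2) + A * (M%:R * h)).
Proof.
move=> cf fA fe r0 M0 z0 N0 zh h0 zg.
have NR : 0 < N by rewrite ltr0n.
set J := \int[_]_t _.
have est : `|\sum_(w <- map (@direction R) zs) f w - N * J| <=
    e * (N + M%:R * (h * N)) + N * (A * 8 / (M%:R * r ^+ 2)) + A * (M%:R * (h * N)).
  rewrite /N -(size_map (@direction R)); apply: fejer_estimate => //.
  - by move=> _ /mapP[z /z0 zz ->]; exact: normc_direction.
  - by move=> m mM; rewrite size_map big_map; exact: zh.
  - by rewrite mulr_ge0.
have c0 : 0 <= 2 * A * (1 + r) / r.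
  have A0 : 0 <= A by exact: le_trans (normr_ge0 _) (fA 0).
  by rewrite divr_ge0 ?(ltW r0)// !mulr_ge0// addr_ge0// ltW.
have dir : `|\sum_(z <- zs) f z - \sum_(w <- map (@direction R) zs) f w| <=
    N * e + 2 * A * (1 + r) / r * (g * N).
  rewrite big_map -sumrB (le_trans (ler_norm_sum _ _ _))//.
  apply: (@le_trans _ _ (\sum_(z <- zs)
      (e + 2 * A * (1 + r) / r * (1 - normc (disc_reflect z))))).
    by rewrite big_seq [leRHS]big_seq; apply: ler_sum => z /z0 zz;
      exact: normr_sub_direction_le.
  rewrite big_split /= -mulr_sumr big_const_seq count_predT iter_addr_0.
  by rewrite -[_ *+ _]mulr_natl lerD2l ler_wpM2l.
rewrite -(ler_pM2l NR) -[X in X * `|_|](gtr0_norm NR) -normrM mulrBr mulVKf ?gt_eqF//.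
rewrite -[_ - _](subrKA (\sum_(w <- map (@direction R) zs) f w)).
rewrite (le_trans (ler_normD _ _))// (le_trans (lerD dir est))//.
by rewrite le_eqVlt; apply/orP; left; apply/eqP; ring.
Qed.

Lemma roots_bounds_negligible (zs : nat -> seq R[i]) (n : nat) (c : R) (D : nat)
    (H e : nat -> R) : (0 < n)%N -> 0 < c ->
  (forall k, size (zs k) = (k.+1 * n)%N) ->
  (exists k0, forall k, (k0 <= k)%N ->
    [/\ forall j, normc (\prod_(z <- zs k) ('X - z%:P))`_j <= H k,
        0 < e k <= normc (\prod_(z <- zs k) ('X - z%:P))`_0,
        ((size (zs k)).+1%:R * H k) ^+ 2 / e k <= c * k.+1%:R ^+ D &
        (size (zs k)).+1%:R ^+ 2 * H k <= c * k.+1%:R ^+ D]) ->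
  forall eps M, 0 < eps -> exists k0, forall k, (k0 <= k)%N ->
    [/\ {in zs k, forall z, z != 0},
      \sum_(z <- zs k) (1 - normc (disc_reflect z)) <= eps * (size (zs k))%:R &
      forall m, (0 < m < M)%N ->
        normc (\sum_(z <- zs k) direction z ^+ m) <= eps * (size (zs k))%:R].
Proof.
move=> n0 c0 sz [k1 hk1] eps M eps0.
(* The budget is eps / 2 for 5 t N and eps / 4 for each of the two logarithmic terms; [b] below is
   the slope of the linear bound on the logarithm that achieves the latter for all m < M. *)
pose t : R := Num.min 8^-1 (eps / 10).
have t0 : 0 < t.
  by rewrite lt_min; apply/andP; split; [rewrite invr_gt0|rewrite divr_gt0].
have t8 : t <= 8^-1 by rewrite ge_min lexx.
have te : 5 * t <= eps / 2.
  have : t <= eps / 10 by rewrite ge_min lexx orbT.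
  lra.
pose b : R := Num.min eps (eps / (4 * (M.+1%:R / t))).
have M1 : 1 <= M.+1%:R :> R by rewrite ler1n.
have b0 : 0 < b by rewrite lt_min eps0 divr_gt0// mulr_gt0// divr_gt0.
have be : b <= eps by rewrite ge_min lexx.
have bM : M.+1%:R / t * b <= eps / 4.
  have : b <= eps / (4 * (M.+1%:R / t)) by rewrite ge_min lexx orbT.
  rewrite ler_pdivlMr; first by move=> ?; lra.
  by rewrite mulr_gt0// divr_gt0// (lt_le_trans ltr01).
have [k2 hk2] := ln_polynomial_le_linear D c0 b0.
exists (maxn k1 k2) => k; rewrite geq_max => /andP[/hk1 [h1 h2 h3 h4] /hk2 lnk].
have [z0 gap pow] := roots_equidistribution_bounds h1 h2.
set N := (size (zs k))%:R : R.
have kN : k.+1%:R <= N by rewrite /N sz ler_nat leq_pmulr.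
have lnle (x : R) : x <= c * k.+1%:R ^+ D -> ln x <= b * N.
  move=> xc; have [x0|x0] := ltP 0 x; last first.
    by rewrite (le_trans (ln_le0 _)) ?(le_trans x0)// mulr_ge0// ltW.
  rewrite (le_trans _ (le_trans lnk (ler_wpM2l (ltW b0) kN)))//.
  by rewrite ler_ln ?posrE// (lt_le_trans x0).
have gapb := le_trans gap (lnle _ h3).
split => //; first by rewrite (le_trans gapb)// ler_wpM2r.
move=> m /andP[m0 mM]; rewrite (le_trans (normc_sum_direction_le m z0))//.
have := pow m t m0; rewrite t0 t8 => /(_ isT) powm.
have mR : m%:R <= M.+1%:R :> R by rewrite ler_nat ltnW// ltnW.
have bN : 0 <= b * N by rewrite mulr_ge0// ltW.
have p1 : m%:R * ln ((size (zs k)).+1%:R ^+ 2 * H k) / t <= eps / 4 * N.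
  apply: (@le_trans _ _ (M.+1%:R / t * b * N)); last by rewrite ler_wpM2r.
  apply: (@le_trans _ _ (m%:R / t * (b * N))).
    by rewrite mulrAC ler_wpM2l ?lnle// divr_ge0// ltW.
  by rewrite -[leRHS]mulrA ler_wpM2r// ler_wpM2r// invr_ge0 ltW.
have p2 : m%:R * \sum_(z <- zs k) (1 - normc (disc_reflect z)) <= eps / 4 * N.
  apply: (@le_trans _ _ (M.+1%:R / t * b * N)); last by rewrite ler_wpM2r.
  apply: (@le_trans _ _ (m%:R * (b * N))); first by rewrite ler_wpM2l.
  rewrite mulrA ler_wpM2r// ler_wpM2r ?(ltW b0)// (le_trans mR)//.
  by rewrite ler_peMr ?ler0n// invf_ge1//; lra.
have p3 : 5 * t * N <= eps / 2 * N by rewrite ler_wpM2r.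
lra.
Qed.

End Equidistribution.

(** * From polynomial bounds to vague convergence *)

Section Deterministic.
Variable R : realType.

Lemma normc_coef_det_monic_mxpoly n k (C : 'I_k -> 'M[R[i]]_n) (T : R) :
  (forall j a b, normc (C j a b) <= T) ->
  forall i, normc (\det (monic_mxpoly C))`_i <= n`!%:R * (1 + k%:R * T) ^+ n.
Proof.
move=> CT i; have := @norm_coef_det_monic_mxpoly _ n k C T%:C.
rewrite -lecR rmorphM rmorphXn rmorphD rmorphM !rmorph_nat rmorph1; apply => j a b.
by rewrite normr_normc lecR.
Qed.

(** The exponent collects N + 1 <= (n + 1) K, H <= n! 2^n K^(3n) (as 1 + K^3 <= 2 K^3) and 1 / e =
    K^(2^(n+1)). The second inequality lets a single power of K serve both logarithms. *)
Lemma polynomial_bounds (n k : nat) (K : R) (H := n`!%:R * (1 + K * K ^+ 2) ^+ n : R)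
    (e := (K ^- 2) ^+ (2 ^ n) : R) : K = k.+1%:R ->
  ((k.+1 * n).+1%:R * H) ^+ 2 / e <=
    (n.+1%:R * n`!%:R * 2 ^+ n) ^+ 2 * K ^+ (2 * (3 * n).+1 + 2 ^ n.+1) /\
  (k.+1 * n).+1%:R ^+ 2 * H <= ((k.+1 * n).+1%:R * H) ^+ 2 / e.
Proof.
move=> KE; have K1 : 1 <= K by rewrite KE ler1n.
have K0 : 0 < K by exact: lt_le_trans ltr01 K1.
have K2 : 1 <= K ^+ 2 by rewrite exprn_ege1.
have H1 : 1 <= H.
  rewrite mulr_ege1 ?ler1n ?fact_gt0// exprn_ege1// lerDl mulr_ge0 ?(ltW K0)//.
  by rewrite (le_trans ler01).
have H0 : 0 <= H by exact: le_trans ler01 H1.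
have N1 : (k.+1 * n).+1%:R <= n.+1%:R * K.
  by rewrite KE -natrM ler_nat [(k.+1 * n)%N]mulnC mulSn -[X in (X <= _)%N]add1n leq_add2r.
have HK : H <= n`!%:R * 2 ^+ n * K ^+ (3 * n).
  rewrite -mulrA ler_wpM2l// exprM -exprMn.
  have K3 : K * K ^+ 2 = K ^+ 3 by rewrite -exprS.
  apply: lerXn2r; rewrite ?nnegrE ?addr_ge0 ?mulr_ge0 ?exprn_ge0 ?(ltW K0)//.
  by rewrite K3 mulr2n mulrDl mul1r lerD2r exprn_ege1.
have eV : e^-1 = K ^+ (2 ^ n.+1) by rewrite /e exprVn invrK -exprM -expnS.
split.
  rewrite eV exprD mulrA ler_wpM2r ?exprn_ge0 ?(ltW K0)//.
  rewrite [(2 * _.+1)%N]mulnC exprM -exprMn; apply: lerXn2r.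
  - by rewrite nnegrE mulr_ge0.
  - by rewrite nnegrE !mulr_ge0// ?exprn_ge0// ltW.
  rewrite exprS; have -> : n.+1%:R * n`!%:R * 2 ^+ n * (K * K ^+ (3 * n)) =
    n.+1%:R * K * (n`!%:R * 2 ^+ n * K ^+ (3 * n)) by ring.
  by rewrite ler_pM.
rewrite [(_ * H) ^+ 2]exprMn eV -[leRHS]mulrA ler_wpM2l ?exprn_ge0// [H ^+ 2]expr2 -[leRHS]mulrA.
by rewrite ler_peMr// mulr_ege1// exprn_ege1.
Qed.

End Deterministic.

Lemma vague_cvg_of_eventual_bounds (R : realType) (n : nat)
    (C : forall k, 'I_k -> 'M[R[i]]_n) : (0 < n)%N ->
  (exists k0, forall k, (k0 <= k)%N ->
    (forall (j : 'I_k.+1) a b, normc (C k.+1 j a b) <= k.+1%:R ^+ 2) /\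
    (k.+1%:R ^- 2) ^+ (2 ^ n) <= normc (\det (C k.+1 ord0))) ->
  vague_cvg (fun k => esd k (monic_mxpoly (C k))) (unif_circle R).
Proof.
move=> n0 [k0 hk] f cf suppf.
have [A fA] := compact_support_bounded cf suppf.
have A0 : 0 <= A by exact: le_trans (normr_ge0 _) (fA 0).
rewrite (integral_unif_circle cf fA) -cvg_shiftS.
pose zs k := eigenvalues (monic_mxpoly (C k.+1)).
have szs k : size (zs k) = (k.+1 * n)%N by exact: size_eigenvalues_monic_mxpoly.
have intE k : (\int[esd k.+1 (monic_mxpoly (C k.+1))]_z (f z)%:E)%E =
    ((size (zs k))%:R^-1 * \sum_(z <- zs k) f z)%:E.
  by rewrite integral_esd// szs; congr (_ * _)%:E; rewrite (big_nth 0) szs big_mkord.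
under eq_fun do rewrite intE.
apply/fine_cvgP; split; first exact: nearW.
apply/cvgrPdist_le => eps eps0.
(* Choices in order: r by uniform continuity, M from r and A, h from M, g from r. The error terms
   then use one eps / 8 each, except e (1 + M h), which uses two: six eighths in all. *)
have eps8 : 0 < eps / 8 by rewrite divr_gt0.
have [r r0 fr] := compact_support_unif_continuous cf suppf eps8.
pose M := (Num.trunc (A * 8 / r ^+ 2 / (eps / 8))).+1.
have r20 : 0 < r ^+ 2 by rewrite exprn_gt0.
have M0 : 0 < M%:R :> R by [].
have AM : A * 8 / (M%:R * r ^+ 2) <= eps / 8.
  have : A * 8 / r ^+ 2 / (eps / 8) <= M%:R by rewrite ltW// truncnS_gt.
  rewrite ler_pdivrMr// => h; rewrite invfM mulrA mulrAC ler_pdivrMr//.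
  by rewrite [leRHS]mulrC.
pose h := Num.min 1 (eps / 8 / (A + 1)) / M%:R.
have A1 : 0 < A + 1 by rewrite ltr_wpDl.
have Mh : M%:R * h = Num.min 1 (eps / 8 / (A + 1)).
  by rewrite mulrC divfK// gt_eqF.
have h0 : 0 < h.
  by rewrite divr_gt0// lt_min ltr01 /= divr_gt0.
have Mh1 : M%:R * h <= 1 by rewrite Mh ge_min lexx.
have AMh : A * (M%:R * h) <= eps / 8.
  have : M%:R * h <= eps / 8 / (A + 1) by rewrite Mh ge_min lexx orbT.
  rewrite ler_pdivlMr// => h1; rewrite (le_trans _ h1)//.
  by rewrite mulrDr mulr1 mulrC lerDl mulr_ge0// ltW.
set q := 2 * A * (1 + r) / r.
have q0 : 0 <= q by rewrite divr_ge0 ?(ltW r0)// !mulr_ge0// addr_ge0// ltW.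
have q1 : 0 < q + 1 by rewrite ltr_wpDl.
pose g := eps / 8 / (q + 1).
have g0 : 0 < g by rewrite divr_gt0.
have qg : q * g <= eps / 8.
  by rewrite /g mulrA ler_pdivrMr// mulrC ler_wpM2l ?(ltW eps8)// lerDl.
pose H k : R := n`!%:R * (1 + k.+1%:R * k.+1%:R ^+ 2) ^+ n.
pose e k : R := (k.+1%:R ^- 2) ^+ (2 ^ n).
have c0 : 0 < (n.+1%:R * n`!%:R * 2 ^+ n) ^+ 2 :> R.
  by rewrite exprn_gt0// !mulr_gt0// ?exprn_gt0// ltr0n fact_gt0.
have bounds : exists k0, forall k, (k0 <= k)%N ->
    [/\ forall j, normc (\prod_(z <- zs k) ('X - z%:P))`_j <= H k,
        0 < e k <= normc (\prod_(z <- zs k) ('X - z%:P))`_0,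
        ((size (zs k)).+1%:R * H k) ^+ 2 / e k <=
          (n.+1%:R * n`!%:R * 2 ^+ n) ^+ 2 * k.+1%:R ^+ (2 * (3 * n).+1 + 2 ^ n.+1) &
        (size (zs k)).+1%:R ^+ 2 * H k <=
          (n.+1%:R * n`!%:R * 2 ^+ n) ^+ 2 * k.+1%:R ^+ (2 * (3 * n).+1 + 2 ^ n.+1)].
  exists k0 => k /hk [Cb Cdet].
  have [b1 b2] := @polynomial_bounds R n k _ (erefl _).
  rewrite /zs -det_monic_mxpoly_eigenvalues szs; split => //.
  - exact: normc_coef_det_monic_mxpoly.
  - by rewrite coef0_det_monic_mxpoly Cdet andbT exprn_gt0// invr_gt0 exprn_gt0.
  - exact: le_trans b2 b1.
have ep0 : 0 < Num.min h g by rewrite lt_min h0.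
have [k1 hk1] := roots_bounds_negligible n0 c0 szs bounds M ep0.
exists k1 => // k /= /hk1 [z0 gap pow].
have szg : (0 < size (zs k))%N by rewrite szs muln_gt0.
have gapg : \sum_(z <- zs k) (1 - normc (disc_reflect z)) <= g * (size (zs k))%:R.
  by rewrite (le_trans gap)// ler_wpM2r// ge_min lexx orbT.
have powh m : (0 < m < M)%N ->
    normc (\sum_(z <- zs k) direction z ^+ m) <= h * (size (zs k))%:R.
  by move=> /pow /le_trans; apply; rewrite ler_wpM2r// ge_min lexx.
rewrite distrC (le_trans (average_roots_estimate cf fA fr r0 _ z0 szg powh (ltW h0) gapg))//.
have : eps / 8 * (1 + M%:R * h) <= eps / 8 * 2.
  by rewrite ler_wpM2l ?(ltW eps8)//; lra.
by rewrite -/q; lra.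
Qed.

Theorem theorem4p1 (R : realType) (d : measure_display)
    (Omega : measurableType d) (P : probability Omega R)
    (n : nat) (n_ge1 : (1 <= n)%N)
    (C : forall k : nat, 'I_k -> 'I_n -> 'I_n -> {RV P >-> borelC R})
    (C_normal : forall k (j : 'I_k) (a b : 'I_n),
      standard_complex_normal (C k j a b))
    (C_indep : mutually_independent P
      (fun i : {k : nat & ('I_k * 'I_n * 'I_n)%type} =>
         let: existT k (j, a, b) := i in C k j a b : Omega -> borelC R)) :
  {ae P, forall w,
    vague_cvg
      (fun k => esd k (monic_mxpoly
         (fun j : 'I_k => \matrix_(a < n, b < n) (C k j a b w : R[i]))))
      (unif_circle R)}.
Proof.
apply: filterS (ae_eventually_entries_det_bounds C_normal C_indep) => w [k0 hk].
apply: (@vague_cvg_of_eventual_bounds _ _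
  (fun k (j : 'I_k) => \matrix_(a < n, b < n) (C k j a b w : R[i]))) => //.
exists k0 => k /hk [entries det]; split => // j a b.
by rewrite mxE.
Qed.
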